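(* Consider the regression model and the centered random forest predictor $\widehat Y$ described in the context, with split probabilities $(p_j)_{1\le j\le d}$ and tree-size parameter $k_n$. Let $\mathcal{P} := \{ j : p_j \neq 0 \}$ and $d_0 := \#\mathcal{P}$, and suppose $\lceil\log_2 k_n\rceil\, p_j \ge 1$ for every $j\in\mathcal{P}$. Then, conditional on $(p_j)_{1 \le j \le d}$, $$\mathbb{E}[(\widehat Y(\mathbf{X})-\overline Y(\mathbf{X}))^2] \ge \frac{\sigma^2 k_n}{5n}\cdot \frac{47^{-d_0}}{\prod_{j\in\mathcal{P}}p_j \times \lceil\log_2 k_n\rceil^{d_0-1}}.$$
   Context: Regression model: $\mathcal{D}_n=\{(\mathbf{X}_i,Y_i)\}_{1\le i\le n}$ are i.i.d. copies of $(\mathbf{X},Y)$, $\mathbf{X}$ uniform on $[0,1]^d$, $Y_i=f(\mathbf{X}_i)+\varepsilon_i$ with $f(\mathbf{x})=\mathbb{E}[Y\mid\mathbf{X}=\mathbf{x}]$ and i.i.d. errors $\varepsilon_i$; $\mathbb{E}[Y^2]<\infty$ and $\mathrm{Var}(Y\mid\mathbf{X})\equiv\sigma^2$ for a positive constant $\sigma^2$. The new input $\mathbf{X}$ is independent of $\mathcal{D}_n$. Centered random forest: given $(p_j)_{1\le j\le d}$ with $p_j\ge0$, $\sum_jp_j=1$, and a deterministic $k_n\ge1$, a random partition of $[0,1]^d$ is generated using a randomizing variable $\Theta$ independent of $\mathbf{X}$ and $\mathcal{D}_n$ as follows. Start with the root node $[0,1]^d$. At each node, independently select one feature $j\in\{1,\dots,d\}$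 with probability $p_j$ and split the node at the midpoint of its interval along direction $j$. Repeat for the two daughter nodes until each node has been split exactly $\lceil\log_2k_n\rceil$ times (i.e. the tree is a full binary tree of depth $\lceil\log_2 k_n\rceil$). The $p_j$ may be random through a second sample $\mathcal{D}'_n$ independent of $\mathcal{D}_n$ and $\mathbf{X}$; expectations are conditional on them, i.e. they are treated as fixed. Predictor: let $\mathbf{t}$ be the terminal node containing $\mathbf{X}$, $N(\mathbf{t})=\sum_{i=1}^n\mathbf{1}\{\mathbf{X}_i\in\mathbf{t}\}$, and $W_i=\mathbf{1}\{\mathbf{X}_i\in\mathbf{t}\}/N(\mathbf{t})$ if $N(\mathbf{t})\ne0$, $W_i=0$ otherwise. Then $\widehat Y(\mathbf{X})=\sum_{i=1}^n\mathbb{E}_\Theta[W_i]Y_i$, where $\mathbb{E}_\Theta$ is expectation over $\Theta$ conditionally on $\mathbf{X}$ and $\mathcal{D}_n$, and $\overline Y(\mathbf{X})=\mathbb{E}[\widehat Y(\mathbf{X})\mid\mathbf{X}_1,\dots,\mathbf{X}_n,\mathbf{X}]$.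
   Formalization: The formal theorem adds the assumption k_n ≤ n; without it the inequality fails, e.g. for n = d = 1, p_1 = 1, k_n = 16, where the left side is σ²/16 and the right side is 16σ²/235. *)

(* Defs.v *)
From HB Require Import structures.
From mathcomp Require Import all_boot all_order all_algebra.
From mathcomp Require Import all_classical all_reals all_analysis.

Set Implicit Arguments.
Unset Strict Implicit.
Unset Printing Implicit Defensive.

Import Order.TTheory GRing.Theory Num.Theory.
Import numFieldNormedType.Exports.

Local Open Scope classical_set_scope.
Local Open Scope ring_scope.

Section Probability.
Context {dO : measure_display} {Omega : measurableType dO} {R : realType}.
Variable P : probability Omega R.

Definition sigma_gen {dE : measure_display} {E : measurableType dE}
    (Z : Omega -> E) : set (set Omega) :=
  preimage_set_system setT Z measurable.

(* For Z valued in a finite type, which carries the discrete sigma-algebra. *)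
Definition sigma_gen_discrete {E : finType} (Z : Omega -> E) :
    set (set Omega) :=
  preimage_set_system setT Z setT.

Definition independent (F G : set (set Omega)) : Prop :=
  forall A B, F A -> G B -> (P (A `&` B) = P A * P B)%E.

(* The sigma-algebras F i contain setT, so that the product rule over the
   whole family contains the product rule over each subfamily. *)
Definition mutually_independent {n : nat} (F : 'I_n -> set (set Omega)) :
    Prop :=
  forall A : 'I_n -> set Omega, (forall i, F i (A i)) ->
    (P [set w | forall i, A i w] = \prod_(i < n) P (A i))%E.

Definition identically_distributed {dE : measure_display}
    {E : measurableType dE} (Z Z' : Omega -> E) : Prop :=
  forall B, measurable B -> P (Z @^-1` B) = P (Z' @^-1` B).

(* V is a version of the conditional expectation of U given the
   sigma-algebra G. *)
Definition cond_expectation (G : set (set Omega)) (U V : Omega -> R) : Prop :=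
  [/\ P.-integrable setT (EFin \o U),
      P.-integrable setT (EFin \o V),
      forall B : set R, measurable B -> G (V @^-1` B) &
      forall A, G A -> (\int[P]_(w in A) (V w)%:E = \int[P]_(w in A) (U w)%:E)%E].

(* The law of X is the d-fold product of the uniform law on [0, 1]. *)
Definition uniform_on_cube {d : nat} (X : Omega -> d.-tuple R) : Prop :=
  forall B : 'I_d -> set R, (forall j, measurable (B j)) ->
    (P [set w | forall j, B j (tnth (X w) j)] =
     \prod_(j < d) uniform_prob (@ltr01 R) (B j))%E.

End Probability.

Section RegressionModel.
Context {dO : measure_display} {Omega : measurableType dO} {R : realType}.
Variable P : probability Omega R.
Context {d n : nat}.
Variables (X : Omega -> d.-tuple R) (Y : Omega -> R).
Variables (Xs : 'I_n -> Omega -> d.-tuple R) (Ys : 'I_n -> Omega -> R).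

Definition sample (w : Omega) : n.-tuple (d.-tuple R * R) :=
  [tuple (Xs i w, Ys i w) | i < n].

(* X is both the generic input of the pair (X, Y) and the new input at which
   the forest is evaluated. *)
Record regression_model (eps : 'I_n -> Omega -> R) (f : d.-tuple R -> R)
    (sigma : R) : Prop := RegressionModel {
  model_meas : measurable_fun setT X /\ measurable_fun setT Y ;
  model_sample_meas : forall i,
    measurable_fun setT (Xs i) /\ measurable_fun setT (Ys i) ;
  model_uniform : uniform_on_cube P X ;
  model_copies : forall i, identically_distributed P
    (fun w => (Xs i w, Ys i w)) (fun w => (X w, Y w)) ;
  model_indep : mutually_independent P
    (fun i => sigma_gen (fun w => (Xs i w, Ys i w))) ;
  model_new_input : independent P (sigma_gen X) (sigma_gen sample) ;
  model_square : ('E_P[fun w => (Y w ^+ 2)%R] < +oo)%E ;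
  (* f (x) = E[Y | X = x] *)
  model_f_meas : measurable_fun setT f ;
  model_f : cond_expectation P (sigma_gen X) Y (f \o X) ;
  model_eps : forall i w, Ys i w = f (Xs i w) + eps i w ;
  model_eps_indep : mutually_independent P (fun i => sigma_gen (eps i)) ;
  model_eps_id : forall i i', identically_distributed P (eps i) (eps i') ;
  (* Var (Y | X) = sigma ^ 2, with f \o X in the role of E[Y | X] *)
  model_sigma : 0 < sigma ;
  model_var : cond_expectation P (sigma_gen X)
    (fun w => (Y w - f (X w)) ^+ 2) (cst (sigma ^+ 2)) }.

End RegressionModel.

Section CenteredTree.
Context {R : realType} {d : nat}.

(* The interval of the box along direction j is (lower end, upper end). *)
Definition box : Type := 'I_d -> R * R.

Definition unit_box : box := fun _ => (0, 1).

(* The intervals are closed on the left and open on the right, except those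
   ending at 1, which are closed: the leaves of a tree then partition the unit
   cube. *)
Definition in_box (B : box) (x : d.-tuple R) : bool :=
  [forall j : 'I_d, ((B j).1 <= tnth x j) &&
    ((tnth x j < (B j).2) || (((B j).2 == 1) && (tnth x j == 1)))].

Definition midpoint (I : R * R) : R := (I.1 + I.2) / 2.

Definition lower_half (B : box) (j : 'I_d) : box := fun i =>
  if i == j then ((B j).1, midpoint (B j)) else B i.

Definition upper_half (B : box) (j : 'I_d) : box := fun i =>
  if i == j then (midpoint (B j), (B j).2) else B i.

End CenteredTree.
Arguments box R d : clear implicits.
Arguments unit_box R d : clear implicits.

(* Full binary trees of depth K with a feature at each internal node; these
   are the values of the randomizing variable. A tree of positive depth is
   (feature at the root, lower subtree, upper subtree). *)
Fixpoint ctree (d K : nat) : finType :=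
  if K is K'.+1 then ('I_d * ctree d K' * ctree d K')%type : finType
  else unit.

Fixpoint leaves {R : realType} {d K : nat} :
    ctree d K -> box R d -> seq (box R d) :=
  match K return ctree d K -> box R d -> seq (box R d) with
  | 0 => fun _ B => [:: B]
  | K'.+1 => fun t B => let: (j, tl, tu) := t in
      leaves tl (lower_half B j) ++ leaves tu (upper_half B j)
  end.

(* Product over the internal nodes of the probabilities of their features. *)
Fixpoint ctree_prob {R : realType} {d K : nat} (p : 'I_d -> R) :
    ctree d K -> R :=
  match K return ctree d K -> R with
  | 0 => fun _ => 1
  | K'.+1 => fun t => let: (j, tl, tu) := t in
      p j * ctree_prob p tl * ctree_prob p tu
  end.

(* ceil (log_2 k); the integer is nonnegative when k >= 1, so that the
   absolute value only casts it to nat. *)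
Definition depth {R : realType} (k : R) : nat :=
  `|Num.ceil (ln k / ln 2)|%N.

Section CenteredForest.
Context {R : realType} {d n K : nat}.

(* z belongs to the terminal node containing x. *)
Definition same_leaf (t : ctree d K) (x z : d.-tuple R) : bool :=
  has (fun B => in_box B x && in_box B z) (leaves t (unit_box R d)).

Definition leaf_count (t : ctree d K) (x : d.-tuple R)
    (xs : 'I_n -> d.-tuple R) : nat :=
  \sum_(i < n) same_leaf t x (xs i).

Definition weight (t : ctree d K) (x : d.-tuple R)
    (xs : 'I_n -> d.-tuple R) (i : 'I_n) : R :=
  if leaf_count t x xs == 0%N then 0
  else (same_leaf t x (xs i))%:R / (leaf_count t x xs)%:R.

Context {dO : measure_display} {Omega : measurableType dO}.
Variable P : probability Omega R.
Variables (X : Omega -> d.-tuple R).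
Variables (Xs : 'I_n -> Omega -> d.-tuple R) (Ys : 'I_n -> Omega -> R).

Record centered_forest (p : 'I_d -> R) (Theta : Omega -> ctree d K) : Prop :=
  CenteredForest {
  forest_p_ge0 : forall j, 0 <= p j ;
  forest_p_sum : \sum_(j < d) p j = 1 ;
  forest_meas : sigma_gen_discrete Theta `<=` measurable ;
  forest_law : forall t, P (Theta @^-1` [set t]) = (ctree_prob p t)%:E ;
  forest_indep : independent P (sigma_gen_discrete Theta)
    (sigma_gen (fun w => (X w, sample Xs Ys w))) }.

(* EW i is a version of the expectation of the weight W_i over Theta,
   conditionally on X and the sample. *)
Definition forest_weights (Theta : Omega -> ctree d K)
    (EW : 'I_n -> Omega -> R) : Prop :=
  forall i, cond_expectation P (sigma_gen (fun w => (X w, sample Xs Ys w)))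
    (fun w => weight (Theta w) (X w) (Xs ^~ w) i) (EW i).

Definition forest_predictor (EW : 'I_n -> Omega -> R) (w : Omega) : R :=
  \sum_(i < n) EW i w * Ys i w.

(* Ybar is a version of E[Yhat | X_1, ..., X_n, X]. *)
Definition forest_mean (Yhat Ybar : Omega -> R) : Prop :=
  cond_expectation P
    (sigma_gen (fun w => ([tuple Xs i w | i < n], X w))) Yhat Ybar.

End CenteredForest.

Definition active {R : realType} {d : nat} (p : 'I_d -> R) : {set 'I_d} :=
  [set j | p j != 0]%SET.

(* Main.v *)
(* Given the inputs, the predictor minus its mean is sum_i w_i e_i with
   w_i = E_Theta[W_i] and e_i = Y_i - f(X_i), so the left-hand side equals
   sigma^2 sum_i E[w_i^2].  Let S_ti be the indicator that X and X_i share a leaf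
   of t, N_t = sum_l S_tl, c_i = sum_t P(t) S_ti and K = ceil(log_2 k).  Since N_t
   has mean 1/b := 1 + (n - 1) 2^-K given X, X_i and S_ti = 1, Jensen's inequality
   gives E[w_i^2] >= b^2 E[c_i^2].  The numbers of splits along each direction on
   the way from the root to the leaf of X are multinomial (K, p), whence
   c_i = sum_m q(m) A_m with q the multinomial mass function and A_m the indicator
   that X and X_i agree up to dyadic level m_j in every direction j.  As
   E[A_m] = 2^-K, this yields E[c_i^2] >= 2^-K sum_m q(m)^2.  The collision
   probability sum_m q(m)^2 is bounded below by the Cauchy-Schwarz inequality
   against exp(- sum_(j <> j0) (m_j - K p_j)^2 / (2 K p_j)), where j0 maximizes p:
   omitting j0, which the constraint sum_j m_j = K determines, gives d_0 - 1 as the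
   power of K. *)

Require Import Defs.
From HB Require Import structures.
From mathcomp Require Import all_boot all_order all_algebra.
From mathcomp Require Import all_classical all_reals all_analysis.
From mathcomp Require Import measurable_realfun ring lra zify.

Set Implicit Arguments.
Unset Strict Implicit.
Unset Printing Implicit Defensive.

Import Order.TTheory GRing.Theory Num.Theory.
Import numFieldNormedType.Exports.

Local Open Scope classical_set_scope.
Local Open Scope ring_scope.

(** * Multinomial counts and their collision probability *)

Section Multinomial.
Context {R : realType} {d : nat}.
Variable p : 'I_d -> R.
Implicit Types (m : {ffun 'I_d -> nat}) (phi psi : {ffun 'I_d -> nat} -> R).

(** [EW] and [Ybar] are versions of conditional expectations, known only up to null sets. They are
    tamed by a finite table recording which training inputs share the leaf of [X] in each tree: the
    averaged weight is a function of that table, so pulling it out of an expectation is a finite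
    sum, and what remains reduces to events of product form in [X] and the sample pairs.

    Paths in random trees are never followed. The formula for c_i is proved by induction on the
    depth, counting leaves shared by two points. A_m is itself the shared-leaf indicator of one
    particular tree, with 2^K leaves of volume 2^-K, whence E[A_m] = 2^K (2^-K)^2.

    Constants: 5 in k / (5 n) is the worst case of comparing 2^K with k and n. For the collision
    probability, each direction other than j0 costs 5 for a Gaussian sum and 4 for e <= 4. The
    probability of j0, missing from the product of the Gaussian sums, is restored through p_j0 >= 1
    / d_0, and 47 absorbs the resulting d_0 20^(d_0 - 1). *)

Definition incr (j : 'I_d) m : {ffun 'I_d -> nat} :=
  [ffun i => (m i + (i == j))%N].

(* Expectation of phi at the vector of counts of K independent draws from p. *)
Fixpoint multi_exp (K : nat) phi : R :=
  if K is K'.+1 then \sum_j p j * multi_exp K' (fun m => phi (incr j m))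
  else phi [ffun=> 0%N].

Definition multi_supp (K : nat) m : bool :=
  (\sum_j m j == K)%N && [forall j, (p j == 0) ==> (m j == 0%N)].

Lemma multi_supp_incr K m j : p j != 0 -> multi_supp K m ->
  multi_supp K.+1 (incr j m).
Proof.
move=> pj0 /andP[/eqP sm /forallP m0]; apply/andP; split.
  rewrite (eq_bigr (fun i => m i + (i == j))%N); last by move=> i _; rewrite ffunE.
  rewrite big_split /= sm -big_mkcond /= sum1_card card1; apply/eqP; lia.
apply/forallP => i; apply/implyP => pi0; rewrite ffunE.
have := m0 i; rewrite pi0 /= => /eqP ->; have [ij|//] := eqVneq i j.
by rewrite -ij pi0 in pj0.
Qed.

Lemma multi_expD K phi psi :
  multi_exp K (fun m => phi m + psi m) = multi_exp K phi + multi_exp K psi.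
Proof.
elim: K phi psi => //= K IH phi psi; rewrite -big_split /=.
by apply: eq_bigr => j _; rewrite IH mulrDr.
Qed.

Lemma multi_expZ K c phi :
  multi_exp K (fun m => c * phi m) = c * multi_exp K phi.
Proof.
elim: K phi => //= K IH phi; rewrite mulr_sumr.
by apply: eq_bigr => j _; rewrite IH mulrCA.
Qed.

Lemma multi_exp_sum K (I : Type) (r : seq I) (Q : pred I)
    (phi : I -> {ffun 'I_d -> nat} -> R) :
  multi_exp K (fun m => \sum_(i <- r | Q i) phi i m) =
  \sum_(i <- r | Q i) multi_exp K (phi i).
Proof.
elim: r => [|i r IH].
  under [X in multi_exp K X]funext do rewrite big_nil.
  rewrite big_nil; have := multi_expZ K 0 (fun=> 0).
  by under [X in multi_exp K X]funext do rewrite mul0r; rewrite mul0r.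
rewrite big_cons; under [X in multi_exp K X]funext do rewrite big_cons.
case: ifP => Qi; last exact: IH.
by rewrite multi_expD IH.
Qed.

Lemma eq_multi_exp K phi psi : (forall m, multi_supp K m -> phi m = psi m) ->
  multi_exp K phi = multi_exp K psi.
Proof.
elim: K phi psi => [|K IH] phi psi eqm /=.
  apply: eqm; apply/andP; split; first by rewrite big1// => j _; rewrite ffunE.
  by apply/forallP => j; rewrite ffunE implybT.
apply: eq_bigr => j _; have [->|pj] := eqVneq (p j) 0; first by rewrite !mul0r.
by congr (_ * _); apply: IH => m vm; apply: eqm; exact: multi_supp_incr.
Qed.

Hypothesis p_ge0 : forall j, 0 <= p j.
Hypothesis p_sum : \sum_j p j = 1.

Lemma le_multi_exp K phi psi : (forall m, phi m <= psi m) ->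
  multi_exp K phi <= multi_exp K psi.
Proof.
elim: K phi psi => [|K IH] phi psi le /=; first exact: le.
by apply: ler_sum => j _; apply: ler_wpM2l => //; exact: IH.
Qed.

Lemma multi_exp_cst K c : multi_exp K (fun=> c) = c.
Proof.
elim: K => //= K ->; by rewrite -mulr_suml p_sum mul1r.
Qed.

Lemma multi_exp_mean K j : multi_exp K (fun m => (m j)%:R) = K%:R * p j.
Proof.
elim: K => /= [|K IH]; first by rewrite ffunE mul0r.
transitivity (\sum_i p i * (K%:R * p j + (j == i)%:R)).
  apply: eq_bigr => i _; congr (_ * _).
  under [X in multi_exp K X]funext do rewrite ffunE natrD.
  by rewrite multi_expD IH multi_exp_cst.
under eq_bigr do rewrite mulrDr.
rewrite big_split /= -mulr_suml p_sum mul1r (bigD1 j)//= eqxx mulr1 big1.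
  by rewrite addr0 -natr1 mulrDl mul1r.
by move=> i /negPf; rewrite eq_sym => ->; rewrite mulr0.
Qed.

Lemma multi_exp_square K j : multi_exp K (fun m => (m j)%:R ^+ 2) =
  K%:R * p j * (1 - p j) + (K%:R * p j) ^+ 2.
Proof.
elim: K => /= [|K IH]; first by rewrite ffunE expr0n /= !mul0r expr0n addr0.
transitivity (\sum_i p i * ((K%:R * p j * (1 - p j) + (K%:R * p j) ^+ 2)
    + (j == i)%:R * (2 * (K%:R * p j) + 1))).
  apply: eq_bigr => i _; congr (_ * _); rewrite -IH.
  rewrite -multi_exp_mean -(multi_expZ K 2) -[X in _ + X * _](multi_exp_cst K).
  (* The increment is 0 or 1, hence equal to its square. *)
  have E m : (incr i m j)%:R ^+ 2 =
     (m j)%:R ^+ 2 + (j == i)%:R * (2 * (m j)%:R + 1) :> R.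
    by rewrite ffunE natrD; case: (j == i) => /=; ring.
  under [X in multi_exp K X]funext do rewrite E.
  rewrite multi_expD multi_expZ multi_expD !multi_exp_cst //.
under eq_bigr do rewrite mulrDr.
rewrite big_split /= -mulr_suml p_sum mul1r (bigD1 j)//= eqxx mul1r big1.
  by rewrite addr0 -natr1; ring.
by move=> i /negPf; rewrite eq_sym => ->; rewrite mul0r mulr0.
Qed.

Lemma multi_exp_variance K j :
  multi_exp K (fun m => ((m j)%:R - K%:R * p j) ^+ 2) =
  K%:R * p j * (1 - p j).
Proof.
have E m : ((m j)%:R - K%:R * p j) ^+ 2 =
   (m j)%:R ^+ 2 + ((- 2 * (K%:R * p j)) * (m j)%:R + (K%:R * p j) ^+ 2) by ring.
under [X in multi_exp K X]funext do rewrite E.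
rewrite multi_expD multi_exp_square multi_expD multi_expZ multi_exp_mean.
by rewrite multi_exp_cst; ring.
Qed.

(** Counts of [K] draws are at most [K]. Bounding them gives a finite index type, over which the
    collision probability is a finite sum. *)
Definition nat_ffun K (m : {ffun 'I_d -> 'I_K.+1}) : {ffun 'I_d -> nat} :=
  [ffun j => nat_of_ord (m j)].

Definition multi_pmf K (m : {ffun 'I_d -> 'I_K.+1}) : R :=
  multi_exp K (fun m' => (m' == nat_ffun m)%:R).

Lemma multi_expE K phi :
  multi_exp K phi = \sum_m multi_pmf m * phi (nat_ffun (m : {ffun 'I_d -> 'I_K.+1})).
Proof.
transitivity (multi_exp K (fun m' => \sum_(m : {ffun 'I_d -> 'I_K.+1})
    phi (nat_ffun m) * (m' == nat_ffun m)%:R)); last first.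
  rewrite multi_exp_sum; apply: eq_bigr => m _.
  by rewrite multi_expZ mulrC.
apply: eq_multi_exp => m /andP[/eqP sm _].
have mj j : (m j < K.+1)%N by rewrite ltnS -sm (bigD1 j)//= leq_addr.
pose m1 : {ffun 'I_d -> 'I_K.+1} := [ffun j => Ordinal (mj j)].
have nm1 : nat_ffun m1 = m by apply/ffunP => j; rewrite !ffunE.
rewrite (bigD1 m1)//= nm1 eqxx mulr1 big1 ?addr0// => m2 m21.
case: eqP => [mm2|]; last by rewrite mulr0.
case/eqP: m21; apply/ffunP => j; apply/val_inj.
by move/ffunP/(_ j): mm2; rewrite /nat_ffun ffunE => e; rewrite ffunE; exact: esym e.
Qed.

Lemma multi_pmf_ge0 K (m : {ffun 'I_d -> 'I_K.+1}) : 0 <= multi_pmf m.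
Proof. by rewrite -(multi_exp_cst K 0); apply: le_multi_exp => m'. Qed.

Lemma multi_pmf0 K (m : {ffun 'I_d -> 'I_K.+1}) : ~~ multi_supp K (nat_ffun m) ->
  multi_pmf m = 0.
Proof.
move=> nv; rewrite -(multi_exp_cst K 0); apply: eq_multi_exp => m' vm.
by case: eqP => // e; rewrite -e vm in nv.
Qed.

End Multinomial.

(** * Gaussian sums and the Cauchy-Schwarz inequality *)

Lemma expRN1_le {R : realType} : expR (-1) <= 2^-1 :> R.
Proof.
have := @expR_ge1Dx R 1; rewrite expRN => h.
by rewrite lef_pV2 ?posrE ?expR_gt0//; lra.
Qed.

(** The tangent bound at [-1] itself gives only 0; at [-1/2] it gives 1/2, which is then squared. *)
Lemma expRN1_ge {R : realType} : 1 / 4 <= expR (-1) :> R.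
Proof.
have := @expR_ge1Dx R (-(1/2)) => h.
have -> : -1 = -(1/2) + -(1/2) :> R by lra.
rewrite expRD; nra.
Qed.

(** Terms with [m < A], where [2 * a < A <= 2 * a + 1], are at most 1. For [m = A + i] the exponent
    is at most [- i], so these terms are dominated by a geometric series of ratio 1/2 and sum 2. The
    total [2 * a + 3] is at most [5 * a] because [1 <= a]. *)
Lemma gauss_sum_le {R : realType} (a : R) (M : nat) : 1 <= a ->
  \sum_(m < M) expR (- ((m%:R - a) ^+ 2 / a)) <= 5 * a.
Proof.
move=> a1; have a0 : 0 < a by lra.
pose A := (Num.trunc (2 * a)).+1.
have A1 : A%:R <= 2 * a + 1.
  by rewrite /A -natr1 lerD2r truncn_le //; lra.
have A2 : 2 * a < A%:R by apply: truncnS_gt; lra.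
have bnd m : expR (- ((m%:R - a) ^+ 2 / a)) <=
   (m < A)%N%:R + (A <= m)%N%:R * 2^-1 ^+ (m - A) :> R.
  case: ltnP => Am /=.
    rewrite mul0r addr0 -[leRHS](@expR0 R) ler_expR oppr_le0.
    by rewrite divr_ge0 ?sqr_ge0 // ltW.
  rewrite add0r mul1r -{1}(subnK Am); move: (m - A)%N => i.
  apply: (@le_trans _ _ (expR (-1) ^+ i)); last first.
    by rewrite lerXn2r ?nnegrE ?expR_ge0 ?expRN1_le.
  rewrite -expRM_natr ler_expR mulN1r lerN2 ler_pdivlMr// natrD.
  have := ler0n R i; nra.
clearbody A; apply: le_trans (ler_sum _ (fun (m : 'I_M) _ => bnd m)) _.
rewrite big_split /=.
have -> : \sum_(m < M) (m < A)%N%:R = (minn A M)%:R :> R.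
  rewrite -(big_mkord xpredT (fun m => (m < A)%N%:R)) /=.
  elim: M => [|M IH]; first by rewrite big_geq// minn0.
  rewrite big_nat_recr//= IH -natrD; congr (_%:R).
  by case: ltnP => h; lia.
have S : \sum_(m < M) (A <= m)%N%:R * 2^-1 ^+ (m - A) <= 2 :> R.
  rewrite -(big_mkord xpredT (fun m => (A <= m)%N%:R * 2^-1 ^+ (m - A))) /=.
  (* The induction needs the exact remainder of the geometric series. *)
  suff : \sum_(0 <= m < M) (A <= m)%N%:R * 2^-1 ^+ (m - A) <=
     2 - 2 * 2^-1 ^+ (M - A) :> R.
    by move=> h; apply: le_trans h _; rewrite gerBl mulr_ge0// exprn_ge0//; lra.
  elim: M => [|M IH]; first by rewrite big_geq// sub0n expr0; lra.
  rewrite big_nat_recr//=; case: leqP => h /=.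
    by rewrite subSn// exprS mul1r; lra.
  have -> : (M.+1 - A = 0)%N by lia.
  have MA : (M - A = 0)%N by lia.
  by move: IH; rewrite MA expr0; lra.
have : (minn A M)%:R <= A%:R :> R by rewrite ler_nat geq_minl.
lra.
Qed.

(** Expand the sum of the squares of [q i - c * h i] with [c = L / H], the best multiplier when both
    bounds are equalities. *)
Lemma sum_sqr_ge {R : realType} (I : finType) (Q : pred I) (q h : I -> R) (L H : R) :
  0 < L -> 0 < H -> L <= \sum_(i | Q i) q i * h i ->
  \sum_(i | Q i) h i ^+ 2 <= H -> L ^+ 2 / H <= \sum_(i | Q i) q i ^+ 2.
Proof.
move=> L0 H0 Lq Hh; pose c := L / H.
have c0 : 0 < c by rewrite divr_gt0.
have : 0 <= \sum_(i | Q i) (q i - c * h i) ^+ 2.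
  by apply: sumr_ge0 => i _; exact: sqr_ge0.
have -> : \sum_(i | Q i) (q i - c * h i) ^+ 2 = \sum_(i | Q i) q i ^+ 2
    - (2 * c) * (\sum_(i | Q i) q i * h i) + c ^+ 2 * \sum_(i | Q i) h i ^+ 2.
  rewrite !mulr_sumr -sumrB -big_split /=; apply: eq_bigr => i _; ring.
have e : L ^+ 2 / H = 2 * c * L - c ^+ 2 * H.
  by rewrite /c; field; rewrite gt_eqF.
have : 2 * c * L <= 2 * c * (\sum_(i | Q i) q i * h i) by rewrite ler_pM2l//; lra.
have : c ^+ 2 * (\sum_(i | Q i) h i ^+ 2) <= c ^+ 2 * H.
  by rewrite ler_pM2l// exprn_gt0.
lra.
Qed.

Section Collision.
Context {R : realType} {d : nat}.
Variables (p : 'I_d -> R) (K : nat).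
Hypothesis p_ge0 : forall j, 0 <= p j.
Hypothesis p_sum : \sum_j p j = 1.
Hypothesis Kp_ge1 : forall j, j \in active p -> 1 <= K%:R * p j.
Notation A := (active p).

Lemma sum_active : \sum_(j in A) p j = 1.
Proof.
rewrite -p_sum [RHS](bigID (mem A))/= [X in _ = _ + X]big1 ?addr0// => j.
by rewrite inE negbK => /eqP.
Qed.

(** The maximum is at least the average. This is the price for leaving one direction out of the
    Gaussian kernel: its probability is bounded below by 1 / d_0 when the full product is
    restored. *)
Lemma active_max_exists : exists2 j, j \in A & 1 <= #|A|%:R * p j.
Proof.
have [j0 j0A] : exists j, j \in A.
  apply/set0Pn; apply: contraTneq isT => A0; have := sum_active.
  by rewrite A0 big_set0 => /eqP; rewrite eq_sym oner_eq0.
case: (@arg_maxP _ _ _ j0 (mem A) p j0A) => j jA jmax.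
exists j => //; rewrite -[leLHS]sum_active mulr_natl -sumr_const; exact: ler_sum.
Qed.

Variable j0 : 'I_d.

(** A term of Pearson's chi-square statistic. *)
Let dev (j : 'I_d) (x : R) := (x - K%:R * p j) ^+ 2 / (K%:R * p j).

(** Jensen's inequality for the exponential, in the form of its tangent line at [- (mu / 2)]. The
    mean of [U] is at most [mu], since each variance [K%:R * p j * (1 - p j)] is at most the
    denominator in [dev]. *)
Lemma kernel_mean_ge :
  expR (- (#|A :\ j0|%:R / 2)) <= multi_exp p K
    (fun m => expR (- ((\sum_(j in A :\ j0) dev j (m j)%:R) / 2))).
Proof.
set mu := #|_|%:R.
set U := fun m : {ffun 'I_d -> nat} => \sum_(j in A :\ j0) dev j (m j)%:R.
have EU : multi_exp p K U <= mu.
  rewrite multi_exp_sum /mu -sumr_const; apply: ler_sum => j.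
  rewrite !inE => /andP[_ pj].
  have aj : 1 <= K%:R * p j by apply: Kp_ge1; rewrite inE.
  rewrite /dev; under [X in multi_exp _ _ X]funext do rewrite mulrC.
  rewrite multi_expZ multi_exp_variance// mulKf ?gt_eqF//; last lra.
  by rewrite gerBl.
apply: (@le_trans _ _ (multi_exp p K (fun m => expR (- (mu / 2)) * (1 + mu / 2)
    + (- expR (- (mu / 2)) / 2) * U m))).
  rewrite multi_expD (multi_expZ _ _ _ U) multi_exp_cst//.
  have := expR_gt0 (- (mu / 2)); set e := expR _ => e0.
  have : e * multi_exp p K U <= e * mu by rewrite ler_pM2l.
  lra.
apply: le_multi_exp => // m.
have -> : - (U m / 2) = - (mu / 2) + (mu / 2 - U m / 2) by lra.
rewrite expRD; have := expR_gt0 (- (mu / 2)).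
have := expR_ge1Dx (mu / 2 - U m / 2).
set e1 := expR _; set e2 := expR _ => h1 h2.
have : e2 * (1 + (mu / 2 - U m / 2)) <= e2 * e1 by rewrite ler_pM2l.
lra.
Qed.

(* Under multi_supp the coordinate at j0 is K minus the sum of the others. *)
Let forget (m : {ffun 'I_d -> 'I_K.+1}) : {ffun 'I_d -> 'I_K.+1} :=
  [ffun j => if j \in A :\ j0 then m j else ord0].

Let forget_inj : {in [pred m | multi_supp p K (nat_ffun m)] &, injective forget}.
Proof.
move=> m m'; rewrite !inE => /andP[/eqP sm /forallP zm] /andP[/eqP sm' /forallP zm'] e.
have ne j : j != j0 -> m j = m' j.
  move=> jj0; have [pj|pj] := eqVneq (p j) 0.
    have := zm j; have := zm' j; rewrite pj eqxx /= !ffunE => /eqP h /eqP h'.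
    by apply/val_inj; rewrite /= h h'.
  by move/ffunP/(_ j): e; rewrite !ffunE !inE jj0 pj.
apply/ffunP => j; have [->|/ne//] := eqVneq j j0; apply/val_inj => /=.
move: sm sm'; rewrite (bigD1 j0)//= [in X in _ -> X -> _](bigD1 j0)//= !ffunE.
have -> : (\sum_(i < d | i != j0) nat_ffun m i = \sum_(i < d | i != j0) nat_ffun m' i)%N.
  by apply: eq_bigr => i /ne; rewrite !ffunE => ->.
by move=> e1 e2; apply/eqP; rewrite -(eqn_add2r (\sum_(i < d | i != j0) nat_ffun m' i)%N) e1 e2.
Qed.

(** By [forget], the admissible count vectors embed into all families indexed by [A :\ j0].
    Distributivity turns the sum over those families into the product; the families outside the
    image contribute nonnegative terms. *)
Lemma kernel_sum_le (G : 'I_d -> nat -> R) : (forall j n, 0 <= G j n) ->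
  \sum_(m : {ffun 'I_d -> 'I_K.+1} | multi_supp p K (nat_ffun m))
     \prod_(j in A :\ j0) G j (m j) <=
  \prod_(j in A :\ j0) \sum_(n < K.+1) G j n.
Proof.
(* The default [ord0] is the value that [forget] puts outside [A :\ j0], so that images of [forget]
   are among the families summed over. *)
move=> G0; rewrite (big_distr_big ord0) /=.
pose F (f : {ffun 'I_d -> 'I_K.+1}) := \prod_(j in A :\ j0) G j (f j).
have F0 f : 0 <= F f by exact: prodr_ge0.
rewrite (eq_bigr (F \o forget)); last first.
  by move=> m _; apply: eq_bigr => j jA; rewrite ffunE jA.
rewrite -(@big_imset _ _ _ _ _ forget
  (mem [pred m | multi_supp p K (nat_ffun m)]) F)/=; last exact: forget_inj.
rewrite [leRHS](bigID (mem (forget @: [pred m | multi_supp p K (nat_ffun m)])))/=.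
apply: ler_wpDr; first by apply: sumr_ge0 => f _; exact: F0.
rewrite le_eqVlt; apply/orP; left; apply/eqP; apply: eq_bigl => f.
rewrite andb_idl// => /imsetP[m _ ->]; apply/pffun_onP; split.
  by apply/fintype.subsetP => j; rewrite inE /= ffunE; case: ifP => //; rewrite eqxx.
by move=> ?.
Qed.

(** Squaring cancels the 1/2 in the exponent, and the square factorizes over the directions.
    [Kp_ge1] is the condition under which [gauss_sum_le] bounds each factor. *)
Lemma kernel_sqr_le :
  \sum_(m : {ffun 'I_d -> 'I_K.+1} | multi_supp p K (nat_ffun m))
    expR (- ((\sum_(j in A :\ j0) dev j (nat_ffun m j)%:R) / 2)) ^+ 2 <=
  \prod_(j in A :\ j0) (5 * (K%:R * p j)).
Proof.
rewrite (eq_bigr (fun m : {ffun 'I_d -> 'I_K.+1} =>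
  \prod_(j in A :\ j0) expR (- dev j (m j)%:R))); last first.
  move=> m _; rewrite -expRM_natr mulNr -mulrA mulVf// mulr1 -sumrN expR_sum.
  by apply: eq_bigr => j _; rewrite ffunE.
apply: le_trans (kernel_sum_le (G := fun j n => expR (- dev j n%:R)) _) _.
  by move=> j n; exact: expR_ge0.
apply: ler_prod => j; rewrite !inE => /andP[_ pj]; apply/andP; split.
  by apply: sumr_ge0 => n _; exact: expR_ge0.
by apply: gauss_sum_le; apply: Kp_ge1; rewrite inE.
Qed.

End Collision.

(** With D = d_0 - 1, Cauchy-Schwarz gives at least e^-D divided by the product of the 5 K p_j over
    j other than j0, hence at least 20^-D divided by K^D and the product of these p_j. Multiplying
    and dividing by p_j0 >= 1 / (D + 1) leaves (D + 1) 20^D to be compared with 47^(D + 1). *)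
Lemma multi_collision {R : realType} {d : nat} (p : 'I_d -> R) (K : nat) :
  (forall j, 0 <= p j) -> \sum_j p j = 1 ->
  (forall j, j \in active p -> 1 <= K%:R * p j) ->
  47 ^- #|active p| / (\prod_(j in active p) p j * K%:R ^+ (#|active p| - 1)) <=
  \sum_(m : {ffun 'I_d -> 'I_K.+1}) multi_pmf p m ^+ 2.
Proof.
move=> p0 p1 Kp; have [j0 j0A pj0] := active_max_exists p1.
have pj j : j \in active p -> 0 < p j by rewrite inE lt_def p0 andbT.
apply: (@le_trans _ _ (\sum_(m : {ffun 'I_d -> 'I_K.+1} |
    multi_supp p K (nat_ffun m)) multi_pmf p m ^+ 2)); last first.
  rewrite [leRHS](bigID (fun m => multi_supp p K (nat_ffun m)))/= lerDl.
  by apply: sumr_ge0 => m _; exact: sqr_ge0.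
pose h (m : {ffun 'I_d -> nat}) : R := expR (- ((\sum_(j in active p :\ j0)
  ((m j)%:R - K%:R * p j) ^+ 2 / (K%:R * p j)) / 2)).
have hL : expR (- (#|active p :\ j0|%:R / 2)) <=
    \sum_(m : {ffun 'I_d -> 'I_K.+1}) multi_pmf p m * h (nat_ffun m).
  by rewrite -multi_expE; exact: kernel_mean_ge.
have hH : \sum_(m : {ffun 'I_d -> 'I_K.+1} | multi_supp p K (nat_ffun m))
    h (nat_ffun m) ^+ 2 <= \prod_(j in active p :\ j0) (5 * (K%:R * p j)).
  exact: kernel_sqr_le.
move: hH hL; set D := #|active p :\ j0|; set H := \prod_(j in _) _ => hH hL.
have cA : #|active p| = D.+1 by rewrite (cardsD1 j0) j0A.
have K0 : 0 < K%:R :> R.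
  by have := Kp _ j0A; have := pj _ j0A; have := ler0n R K; nra.
have H0 : 0 < H.
  apply: prodr_gt0 => j; rewrite !inE => /andP[_ h1].
  by rewrite !mulr_gt0// pj// inE.
apply: le_trans (@sum_sqr_ge _ _ _ (multi_pmf p (K:=K))
   (fun m => h (nat_ffun m)) _ H (expR_gt0 _) H0 _ hH); last first.
  apply: le_trans hL _; rewrite (bigID (fun m => multi_supp p K (nat_ffun m)))/=.
  by rewrite [X in _ + X]big1 ?addr0// => m /(multi_pmf0 p1) ->; rewrite mul0r.
rewrite -expRM_natr mulNr -mulrA mulVf// mulr1.
have -> : H = 5 ^+ D * (K%:R ^+ D * \prod_(j in active p :\ j0) p j).
  by rewrite /H big_split /= prodr_const -/D big_split/= prodr_const.
rewrite (big_setD1 j0)//= cA subn1 /=; set Q := \prod_(j in _) _.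
have Q0 : 0 < Q.
  by apply: prodr_gt0 => j; rewrite !inE => /andP[_ h1]; rewrite pj// inE.
have E : 4^-1 ^+ D <= expR (- D%:R) :> R.
  rewrite -mulN1r expRM_natr lerXn2r ?nnegrE ?expR_ge0 ?invr_ge0//.
  by have := @expRN1_ge R; rewrite div1r.
apply: (@le_trans _ _ (4^-1 ^+ D / (5 ^+ D * (K%:R ^+ D * Q)))); last first.
  by rewrite ler_pM2r// invr_gt0 !mulr_gt0 ?exprn_gt0.
(* In the induction step the left side grows by a factor of at most 40. *)
have C : D.+1%:R * 20 ^+ D <= 47 ^+ D.+1 :> R.
  rewrite -!natrX -natrM ler_nat; elim: D {cA hL E} => // n IH.
  rewrite expnS [leqRHS]expnS; move: IH; set u := (20 ^ _)%N; set v := (47 ^ _)%N.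
  by nia.
have q0 := pj _ j0A; rewrite cA in pj0.
have -> : 4^-1 ^+ D / (5 ^+ D * (K%:R ^+ D * Q)) = (20 ^+ D * (K%:R ^+ D * Q))^-1.
  rewrite (_ : 20 = 4 * 5 :> R); last by rewrite -natrM.
  by rewrite exprMn exprVn !invfM !mulrA.
rewrite -invfM lef_pV2 ?posrE ?mulr_gt0 ?exprn_gt0//.
have -> : 47 ^+ D.+1 * (p j0 * Q * K%:R ^+ D) =
    47 ^+ D.+1 * p j0 * (K%:R ^+ D * Q) by ring.
rewrite ler_pM2r ?mulr_gt0 ?exprn_gt0//.
apply: (@le_trans _ _ (20 ^+ D * (D.+1%:R * p j0))).
  by rewrite ler_peMr// exprn_ge0.
by rewrite mulrA [_ * D.+1%:R]mulrC ler_pM2r.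
Qed.

(** * Dyadic boxes and centered trees *)

Section Geometry.
Context {R : realType}.
Implicit Types (I : R * R) (x z : R).

Definition in_itv01 I x : bool :=
  (I.1 <= x) && ((x < I.2) || ((I.2 == 1) && (x == 1))).

(** Counts the dyadic subintervals of [I] at level [l] that contain both points. As a count it is
    additive over the two halves, without any appeal to their disjointness. *)
Fixpoint itv_agree I (l : nat) x z : nat :=
  if l is l'.+1 then
    (itv_agree (I.1, midpoint I) l' x z + itv_agree (midpoint I, I.2) l' x z)%N
  else in_itv01 I x && in_itv01 I z.

End Geometry.

Section Boxes.
Context {R : realType} {d : nat}.
Implicit Types (B : box R d) (x z : d.-tuple R).

(** A counting form of [same_leaf] for an arbitrary root box: it adds up over the two subtrees, as
    inductions on the depth require. *)
Definition co_leaf K (t : ctree d K) B x z : nat :=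
  \sum_(B' <- leaves t B) (in_box B' x && in_box B' z).

(** For the unit box this is the indicator A_m of the overview. *)
Definition box_agree B (m : 'I_d -> nat) x z : nat :=
  \prod_j itv_agree (B j) (m j) (tnth x j) (tnth z j).

Lemma box_agree0 B x z : box_agree B (fun=> 0%N) x z = in_box B x && in_box B z.
Proof.
rewrite /box_agree /=; case: (boolP (in_box B x && in_box B z)) => h.
  rewrite big1// => j _; case/andP: h => /forallP/(_ j) hx /forallP/(_ j) hz.
  by rewrite /in_itv01 hx hz.
suff [j hj] : exists j, ~~ (in_itv01 (B j) (tnth x j) && in_itv01 (B j) (tnth z j)).
  by rewrite (bigD1 j)//= (negPf hj) mul0n.
move: h; rewrite negb_and => /orP[] /forallPn[j hj]; exists j;
  by rewrite negb_and hj ?orbT.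
Qed.

Lemma box_agree_incr B (m : {ffun 'I_d -> nat}) (j : 'I_d) x z :
  box_agree B (incr j m) x z =
  (box_agree (lower_half B j) m x z + box_agree (upper_half B j) m x z)%N.
Proof.
rewrite /box_agree (bigD1 j)//= [in RHS](bigD1 j)//= [X in _ = (_ + X)%N](bigD1 j)//=.
rewrite /lower_half /upper_half !ffunE eqxx addn1 /= mulnDl.
by congr (_ * _ + _ * _)%N; apply: eq_bigr => i ij;
  rewrite ffunE (negPf ij) addn0.
Qed.

Lemma sum_ctreeS K (F : ctree d K.+1 -> R) :
  \sum_t F t = \sum_j \sum_(tl : ctree d K) \sum_(tu : ctree d K) F (j, tl, tu).
Proof.
rewrite (eq_bigr (fun j => \sum_(q : ctree d K * ctree d K) F (j, q.1, q.2))).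
  rewrite pair_bigA /=.
  rewrite (reindex (fun q : 'I_d * (ctree d K * ctree d K) =>
    (q.1, q.2.1, q.2.2))) //=.
  by exists (fun q : 'I_d * ctree d K * ctree d K => (q.1.1, (q.1.2, q.2))) => [[? []]|[[]]].
by move=> j _; rewrite pair_bigA.
Qed.

Section Average.
Variable p : 'I_d -> R.
Hypothesis p_sum : \sum_j p j = 1.

Lemma sum_ctree_prob K : \sum_(t : ctree d K) ctree_prob p t = 1.
Proof.
elim: K => [|K IH]; first by rewrite (big_pred1 tt)//; case.
rewrite sum_ctreeS -[RHS]p_sum; apply: eq_bigr => j _ /=.
under eq_bigr do rewrite -mulr_sumr IH mulr1.
by rewrite -mulr_sumr IH mulr1.
Qed.

Lemma ctree_prob_ge0 K (t : ctree d K) : (forall j, 0 <= p j) -> 0 <= ctree_prob p t.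
Proof.
by move=> p0; elim: K t => //= K IH [[j tl] tu]; rewrite !mulr_ge0.
Qed.

(** The feature at the root plays the part of the first multinomial draw. The shared leaves of the
    two subtrees add up; in each summand the other subtree is averaged out with total mass 1, and
    [box_agree_incr] recombines the two halves. *)
Lemma sum_co_leaf K B x z :
  \sum_(t : ctree d K) ctree_prob p t * (co_leaf t B x z)%:R =
  multi_exp p K (fun m => (box_agree B m x z)%:R).
Proof.
elim: K B => [|K IH] B.
  rewrite (big_pred1 tt)/=; last by case.
  rewrite mul1r /co_leaf /= big_seq1.
  rewrite -box_agree0; congr (_%:R); apply: eq_bigr => j _; by rewrite ffunE.
rewrite sum_ctreeS /=; apply: eq_bigr => j _.
under [X in multi_exp p K X]funext do rewrite box_agree_incr natrD.
rewrite multi_expD -!IH.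
have E (tl tu : ctree d K) : p j * ctree_prob p tl * ctree_prob p tu *
   (@co_leaf K.+1 (j, tl, tu) B x z)%:R =
   p j * (ctree_prob p tu * (ctree_prob p tl * (co_leaf tl (lower_half B j) x z)%:R)
   + ctree_prob p tl * (ctree_prob p tu * (co_leaf tu (upper_half B j) x z)%:R)).
  by rewrite /co_leaf /= big_cat/= natrD; ring.
under eq_bigr do under eq_bigr do rewrite E.
under eq_bigr do rewrite -mulr_sumr big_split /= -mulr_suml sum_ctree_prob mul1r -mulr_sumr.
by rewrite -mulr_sumr big_split /= -mulr_suml sum_ctree_prob mul1r.
Qed.

End Average.

(* The tree splitting all nodes of a given depth along the same direction. *)
Lemma uniform_ctree K (m : {ffun 'I_d -> nat}) : (\sum_j m j)%N = K ->
  exists t : ctree d K, forall B x z, co_leaf t B x z = box_agree B m x z.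
Proof.
elim: K m => [|K IH] m sm.
  exists tt => B x z; rewrite /co_leaf /= big_seq1 -box_agree0.
  apply: eq_bigr => j _; congr itv_agree.
  by apply/esym/eqP; rewrite -leqn0 -sm (bigD1 j)//= leq_addr.
have [j mj] : exists j, (0 < m j)%N.
  apply/existsP; apply: contraT => /existsPn h.
  by move: sm; rewrite big1// => j _; apply/eqP; rewrite -leqn0 leqNgt h.
pose m' : {ffun 'I_d -> nat} := [ffun i => (m i - (i == j))%N].
have mE : m = incr j m'.
  by apply/ffunP => i; rewrite !ffunE subnK//; case: eqP => // ->.
have [|t ht] := IH m'.
  move: sm; rewrite mE (eq_bigr (fun i => m' i + (i == j))%N); last by move=> i _; rewrite ffunE.
  rewrite big_split /= -[in X in (_ + X)%N]big_mkcond /= sum1_card card1; lia.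
exists (j, t, t) => B x z.
by rewrite mE box_agree_incr -!ht /co_leaf /= big_cat.
Qed.

Definition good_box B := forall j, [/\ 0 <= (B j).1, (B j).1 < (B j).2 & (B j).2 <= 1].

Lemma good_unit_box : good_box (unit_box R d).
Proof. by move=> j; split => //=. Qed.

Lemma good_lower_half B j : good_box B -> good_box (lower_half B j).
Proof.
move=> gB i; have [h1 h2 h3] := gB i; rewrite /lower_half; case: eqP => [ij|//].
by rewrite ij in h1 h2 h3 *; rewrite /midpoint; split => /=; lra.
Qed.

Lemma good_upper_half B j : good_box B -> good_box (upper_half B j).
Proof.
move=> gB i; have [h1 h2 h3] := gB i; rewrite /upper_half; case: eqP => [ij|//].
by rewrite ij in h1 h2 h3 *; rewrite /midpoint; split => /=; lra.
Qed.

(** Inclusion and disjointness in a single inequality, which can be summed along the tree. The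
    midpoint lies below 1, so the clause of [in_box] that closes intervals at 1 never concerns the
    lower half along [j]. *)
Lemma in_box_halves B j x : good_box B ->
  (in_box (lower_half B j) x + in_box (upper_half B j) x <= in_box B x)%N.
Proof.
move=> gB; have [h1 h2 h3] := gB j.
have hl : in_box (lower_half B j) x -> in_box B x.
  move=> /forallP h; apply/forallP => i; have := h i; rewrite /lower_half.
  case: eqP => [->/=|//]; rewrite /midpoint => /andP[-> /=] /orP[l|/andP[/eqP e _]].
    by apply/orP; left; lra.
  lra.
have hu : in_box (upper_half B j) x -> in_box B x.
  move=> /forallP h; apply/forallP => i; have := h i; rewrite /upper_half.
  case: eqP => [->/=|//]; rewrite /midpoint => /andP[l ->]; rewrite andbT; lra.
have hd : in_box (lower_half B j) x -> in_box (upper_half B j) x -> False.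
  move=> /forallP/(_ j) + /forallP/(_ j); rewrite /lower_half /upper_half eqxx /= /midpoint.
  by move=> /andP[_ /orP[l|/andP[/eqP e _]]] /andP[u _]; lra.
move: hl hu hd; case: in_box; case: in_box; case: in_box => //=.
- by move=> _ _ /(_ isT isT).
- by move=> /(_ isT).
- by move=> /(_ isT).
- by move=> _ /(_ isT).
Qed.

Lemma sum_in_leaves K (t : ctree d K) B x : good_box B ->
  (\sum_(B' <- leaves t B) in_box B' x <= in_box B x)%N.
Proof.
elim: K t B => [|K IH] t B gB; first by rewrite /= big_seq1.
case: t => [[j tl] tu] /=; rewrite big_cat /=.
apply: leq_trans (leq_add (IH _ _ _) (IH _ _ _)) _.
- exact: good_lower_half.
- exact: good_upper_half.
- exact: in_box_halves.
Qed.

(** At most one leaf contains [x], so the count is already a truth value. *)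
Lemma same_leafE K (t : ctree d K) x z :
  same_leaf t x z = co_leaf t (unit_box R d) x z :> nat.
Proof.
have h : (co_leaf t (unit_box R d) x z <= 1)%N.
  apply: leq_trans (leq_trans (sum_in_leaves t x good_unit_box) (leq_b1 _)).
  by apply: leq_sum => B _; case: in_box; case: in_box.
move: h; rewrite /same_leaf has_count /co_leaf -big_mkcond sum1_count.
by case: count => [//|[]].
Qed.

Definition box_vol B : R := \prod_j ((B j).2 - (B j).1).

Lemma box_vol_half B j : box_vol (lower_half B j) = box_vol B / 2 /\
  box_vol (upper_half B j) = box_vol B / 2.
Proof.
have E (B' : box R d) : (forall i, i != j -> B' i = B i) -> box_vol B' =
    ((B' j).2 - (B' j).1) * \prod_(i | i != j) ((B i).2 - (B i).1).
  move=> h; rewrite /box_vol (bigD1 j)//=; congr (_ * _).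
  by apply: eq_bigr => i /h ->.
rewrite (E (lower_half B j)) ?(E (upper_half B j)) ?(E B)//; first last.
- by move=> i /negPf h; rewrite /lower_half h.
- by move=> i /negPf h; rewrite /upper_half h.
rewrite /lower_half /upper_half eqxx /midpoint /=; by split; field.
Qed.

Lemma leaves_size K (t : ctree d K) B : size (leaves t B) = (2 ^ K)%N.
Proof.
elim: K t B => [|K IH] t B //=; case: t => [[j tl] tu] /=.
by rewrite size_cat !IH expnS mul2n addnn.
Qed.

(** Each level halves the volume. [List.Forall] expresses the property of all leaves without
    membership in a sequence of functions; [big_Forall] is the matching congruence for sums. *)
Lemma leaves_good K (t : ctree d K) B : good_box B ->
  List.Forall (fun B' => good_box B' /\ box_vol B' = box_vol B / 2 ^+ K) (leaves t B).
Proof.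
elim: K t B => [|K IH] t B gB.
  by constructor => //; rewrite expr0 divr1.
case: t => [[j tl] tu] /=; have [vl vu] := box_vol_half B j.
apply/List.Forall_app; split.
  apply: List.Forall_impl (IH tl _ (good_lower_half j gB)) => B' [g ->].
  by split => //; rewrite vl exprS invfM mulrA.
apply: List.Forall_impl (IH tu _ (good_upper_half j gB)) => B' [g ->].
by split => //; rewrite vu exprS invfM mulrA.
Qed.

Lemma box_vol_unit : box_vol (unit_box R d) = 1.
Proof. by rewrite /box_vol big1// => j _; rewrite subr0. Qed.

End Boxes.

Lemma big_Forall {T : Type} {V : nmodType} (Q : T -> Prop) (s : seq T) (F G : T -> V) :
  List.Forall Q s -> (forall x, Q x -> F x = G x) ->
  \sum_(x <- s) F x = \sum_(x <- s) G x.
Proof.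
move=> Qs FG; elim: Qs => [|x l Qx _ IH]; first by rewrite !big_nil.
by rewrite !big_cons IH FG.
Qed.

(** * Expectations, independence and conditioning *)

Section Expectation.
Context {dO : measure_display} {Omega : measurableType dO} {R : realType}.
Variable P : probability Omega R.
Implicit Types (A : set Omega) (U V W : Omega -> R).

Notation intg U := (P.-integrable setT (EFin \o U)).
Notation E U := (Rintegral P setT U).

Lemma intg_measurable U : intg U -> measurable_fun setT U.
Proof. by move=> /measurable_int /measurable_EFinP. Qed.

Lemma intg_le U V : measurable_fun setT U -> intg V ->
  (forall w, `|U w| <= `|V w|) -> intg U.
Proof.
move=> mU iV UV; apply: le_integrable iV => //; first exact/measurable_EFinP.
by move=> w _; rewrite /= lee_fin.
Qed.

Lemma intg_cst (c : R) : intg (fun=> c).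
Proof.
apply: measurable_bounded_integrable => //; last exact: bounded_cst.
by rewrite (le_lt_trans (probability_le1 P _)) ?ltry.
Qed.

Lemma intg_bounded U (M : R) : measurable_fun setT U ->
  (forall w, `|U w| <= M) -> intg U.
Proof.
move=> mU UM; apply: (intg_le mU (intg_cst M)) => w.
exact: le_trans (UM w) (ler_norm _).
Qed.

Lemma intgD U V : intg U -> intg V -> intg (fun w => U w + V w).
Proof. by move=> iU iV; apply: (integrableD measurableT iU iV). Qed.

Lemma intgZ (c : R) U : intg U -> intg (fun w => c * U w).
Proof. by move=> iU; apply: (integrableZl measurableT c iU). Qed.

Lemma intg_sum (I : Type) (r : seq I) (Q : pred I) (F : I -> Omega -> R) :
  (forall i, Q i -> intg (F i)) -> intg (fun w => \sum_(i <- r | Q i) F i w).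
Proof.
move=> iF; have := integrable_sum measurableT r iF.
by apply: eq_integrable => // w _ /=; rewrite sumEFin.
Qed.

Lemma intg_indic A U : measurable A -> intg U -> intg (fun w => \1_A w * U w).
Proof.
move=> mA iU; apply: (intg_le _ iU) => [|w].
  by apply: measurable_funM; [exact: measurable_indic|exact: intg_measurable].
by rewrite normrM indicE; case: (w \in A) => /=; rewrite ?normr1 ?normr0 ?mul1r ?mul0r.
Qed.

Lemma E_D U V : intg U -> intg V -> E (fun w => U w + V w) = E U + E V.
Proof. by move=> iU iV; rewrite RintegralD. Qed.

Lemma E_Z (c : R) U : intg U -> E (fun w => c * U w) = c * E U.
Proof. by move=> iU; rewrite RintegralZl. Qed.

Lemma E_sum (I : Type) (r : seq I) (Q : pred I) (F : I -> Omega -> R) :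
  (forall i, Q i -> intg (F i)) ->
  E (fun w => \sum_(i <- r | Q i) F i w) = \sum_(i <- r | Q i) E (F i).
Proof.
move=> iF; elim: r => [|i r IH].
  under eq_Rintegral do rewrite big_nil.
  by rewrite Rintegral_cst// mul0r big_nil.
under eq_Rintegral do rewrite big_cons.
rewrite big_cons; case: ifP => Qi; last exact: IH.
by rewrite E_D ?IH//; [exact: iF|exact: intg_sum].
Qed.

Lemma E_le U V : intg U -> intg V -> (forall w, U w <= V w) -> E U <= E V.
Proof. by move=> iU iV UV; apply: le_Rintegral. Qed.

Lemma E_indic A : measurable A -> E \1_A = fine (P A).
Proof. by move=> mA; rewrite /Rintegral integral_indic// setIT. Qed.

Lemma E_cst (c : R) : E (fun=> c) = c.
Proof.
by rewrite Rintegral_cst//= (_ : fine _ = 1) ?mulr1// [X in fine X]probability_setT.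
Qed.

Lemma E_restrict A U : E (fun w => \1_A w * U w) = \int[P]_(w in A) U w.
Proof.
rewrite [RHS]Rintegral_mkcond; apply: eq_Rintegral => w _.
by rewrite patchE indicE; case: (w \in A); rewrite ?mul1r ?mul0r.
Qed.

Lemma Rintegral_EFin A U : measurable A -> intg U ->
  (\int[P]_(w in A) (U w)%:E)%E = (\int[P]_(w in A) U w)%:E.
Proof.
by move=> mA iU; rewrite /Rintegral fineK// integrable_fin_num//; exact: integrableS iU.
Qed.

(** The events on which the signed measure A -> E[1_A W] vanishes form a lambda-system: [Pi setT]
    yields complements, and countable additivity yields disjoint unions. *)
Lemma pi_lambda_zero (Pi : set (set Omega)) W : intg W ->
  setI_closed Pi -> Pi `<=` measurable -> Pi setT ->
  (forall A, Pi A -> E (fun w => \1_A w * W w) = 0) ->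
  forall A, <<s Pi >> A -> E (fun w => \1_A w * W w) = 0.
Proof.
move=> iW PiI Pim PiT PiW.
pose nu : {charge set Omega -> \bar R} := induced_charge iW.
have nuE A : measurable A -> nu A = (E (fun w => \1_A w * W w))%:E.
  by move=> mA; rewrite E_restrict -Rintegral_EFin//.
pose H := [set A : set Omega | measurable A /\ nu A = 0%E].
suff sub : <<s Pi >> `<=` H by move=> A /sub[mA]; rewrite nuE// => -[].
apply: lambda_system_subset => //; last first.
  by move=> A PA; split; [exact: Pim|rewrite nuE ?PiW//; exact: Pim].
apply/dynkin_lambda_system; split.
- by split; [exact: measurableT|rewrite nuE ?PiW].
- move=> A [mA nA]; split; first exact: measurableC.
  have : nu (A `|` ~` A) = (nu A + nu (~` A))%E.
    by rewrite chargeU//; [exact: measurableC|rewrite setICr].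
  by rewrite setUCr nA add0e [LHS]nuE ?PiW// => <-.
- move=> F tF HF; have mF n : measurable (F n) by have [] := HF n.
  split; first exact: bigcup_measurable.
  have := charge_semi_sigma_additive F mF tF (bigcup_measurable (fun n _ => mF n)).
  move=> /(_ R nu).
  rewrite (_ : (fun n => _) = cst 0%E); last first.
    by apply/funext => n; rewrite big1// => i _; have [] := HF i.
  move=> h; have := cvg_cst (0%E : \bar R); move/(_ _ (nbhs \oo) _).
  by move=> h'; apply: cvg_unique h h'.
Qed.

(** The event V < U is the union over rationals q of the events V <= q < U. Each of these is in [G]
    by the measurability of [U] and [V] separately, and is null because the positive difference U -
    V integrates to 0 over it. *)
Lemma cond_exp_unique (G : set (set Omega)) U V : sigma_algebra setT G ->
  G `<=` measurable -> intg U -> intg V ->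
  (forall B : set R, measurable B -> G (U @^-1` B)) ->
  (forall B : set R, measurable B -> G (V @^-1` B)) ->
  (forall A, G A -> E (fun w => \1_A w * U w) = E (fun w => \1_A w * V w)) ->
  {ae P, forall w, U w = V w}.
Proof.
move=> sG Gm.
have half U' V' : intg U' -> intg V' ->
    (forall B : set R, measurable B -> G (U' @^-1` B)) ->
    (forall B : set R, measurable B -> G (V' @^-1` B)) ->
    (forall A, G A -> E (fun w => \1_A w * U' w) = E (fun w => \1_A w * V' w)) ->
    P.-negligible [set w | V' w < U' w].
  move=> iU iV GU GV UV.
  pose C (q : rat) := [set w | V' w <= ratr q] `&` [set w | ratr q < U' w].
  have -> : [set w | V' w < U' w] = \bigcup_q C q.
    apply/seteqP; split => w /=.
      move=> /rat_in_itvoo[q]; rewrite in_itv /= => /andP[q1 q2].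
      by exists q => //; split => //=; exact: ltW.
    by move=> [q _ [/= h1 h2]]; exact: le_lt_trans h2.
  (* Enumerating the rationals by natural numbers makes the union one over a sequence. *)
  have -> : \bigcup_q C q = \bigcup_n (if @unpickle rat n is Some q then C q else set0).
    apply/seteqP; split => [w [q _ Cq]|w [n _]].
      by exists (pickle q); [exact: Logic.I|rewrite pickleK].
    by case: unpickle => // q Cq; exists q.
  apply: negligible_bigcup => n; case: unpickle => [q|]; last exact: negligible_set0.
  have GC : G (C q).
    have -> : C q = V' @^-1` [set` `]-oo, ratr q]] `&` U' @^-1` [set` `]ratr q, +oo[].
      by apply/seteqP; split => w; rewrite /= !in_itv /= andbT.
    have [G0 GCc GU2] := sG.
    have -> : forall A B : set Omega, A `&` B = setT `\` (setT `\` A `|` setT `\` B).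
      by move=> A B; rewrite !setTD setCU !setCK.
    apply: (GCc); rewrite -bigcup2E; apply: GU2 => -[|[|k]] /=.
    - by apply: (GCc); exact: GV.
    - by apply: (GCc); exact: GU.
    - exact: G0.
  have mC := Gm _ GC.
  pose D w := \1_(C q) w * (U' w + -1 * V' w).
  have iD : intg D by apply: intg_indic => //; apply: intgD => //; exact: intgZ.
  have D0 w : 0 <= D w.
    rewrite /D indicE; have [/set_mem[/= h1 h2]|_] := boolP (w \in C q).
      by rewrite mul1r; lra.
    by rewrite mul0r.
  have ED : E D = 0.
    have -> : D = (fun w => \1_(C q) w * U' w + -1 * (\1_(C q) w * V' w)).
      by apply/funext => w; rewrite /D; ring.
    rewrite E_D ?E_Z ?UV//; try exact: intgZ; try exact: intg_indic.
    - by ring.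
    - by apply: intgZ; exact: intg_indic.
  have : (\int[P]_w `|(D w)%:E| = 0)%E.
    under eq_integral do rewrite abse_EFin ger0_norm//.
    by rewrite Rintegral_EFin// ED.
  move/ae_eq_integral_abs => /(_ measurableT) h.
  have := h (measurable_int _ iD); apply: negligibleS => w Cw /=.
  move=> /(_ Logic.I) /eqP; rewrite eqe /D indicE mem_set// mul1r.
  by case: Cw => /= h1 h2; lra.
move=> iU iV GU GV UV; have h1 := half _ _ iU iV GU GV UV.
have h2 := half _ _ iV iU GV GU (fun A GA => esym (UV A GA)).
apply: negligibleS (negligibleU h1 h2) => w /= /eqP.
by rewrite neq_lt => /orP[]; [right|left].
Qed.

Lemma eq_ae_E U V : measurable_fun setT U -> measurable_fun setT V ->
  {ae P, forall w, U w = V w} ->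
  (\int[P]_w (U w)%:E = \int[P]_w (V w)%:E)%E.
Proof.
move=> mU mV UV; apply: ae_eq_integral => //; try exact/measurable_EFinP.
by apply: filterS UV => w ->.
Qed.

(* G = 1_A g and h are independent, so their joint law is a product. *)
Lemma E_indep A (g h : Omega -> R) : measurable A ->
  measurable_fun setT g -> intg h -> intg (fun w => \1_A w * g w) ->
  (forall B C : set R, measurable B -> measurable C ->
    P (A `&` (g @^-1` B `&` h @^-1` C)) = (P (A `&` g @^-1` B) * P (h @^-1` C))%E) ->
  E (fun w => \1_A w * g w * h w) = E (fun w => \1_A w * g w) * E h.
Proof.
move=> mA mg ih iG ind; set G := fun w => \1_A w * g w.
have mG : measurable_fun setT G by exact: intg_measurable.
have mh := intg_measurable ih.
pose X1 : {mfun Omega >-> R} := HB.pack G (isMeasurableFun.Build _ _ _ _ G mG).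
pose X2 : {mfun Omega >-> R} := HB.pack h (isMeasurableFun.Build _ _ _ _ h mh).
have PGh (B C : set R) : measurable B -> measurable C ->
    P (G @^-1` B `&` h @^-1` C) = (P (G @^-1` B) * P (h @^-1` C))%E.
  move=> mB mC.
  have mgB : measurable (g @^-1` B) by rewrite -[X in measurable X]setTI; exact: (mg).
  have mhC : measurable (h @^-1` C) by rewrite -[X in measurable X]setTI; exact: (mh).
  (* [G] is 0 outside [A], so the complement of [A] belongs to the preimage exactly when [B]
     contains 0. *)
  have GE : G @^-1` B = (A `&` g @^-1` B) `|` (if 0 \in B then ~` A else set0).
    apply/seteqP; split => w /=; rewrite /G indicE.
      have [/set_mem Aw|/negP Aw] := boolP (w \in A).
        by rewrite mul1r; left.
      rewrite mul0r => B0; right; rewrite mem_set//=; move=> Aw'; apply: Aw; exact: mem_set.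
    move=> [[Aw Bw]|]; first by rewrite mem_set// mul1r.
    by case: ifPn => // /set_mem B0 Aw; rewrite memNset// mul0r.
  have indA : P (A `&` h @^-1` C) = (P A * P (h @^-1` C))%E.
    by have := ind setT C measurableT mC; rewrite preimage_setT setTI setIT.
  (* Obtained by subtracting the product rule for [A] from the total probability of the event on
     [h]. *)
  have indAc : P (~` A `&` h @^-1` C) = (P (~` A) * P (h @^-1` C))%E.
    have fA S : measurable S -> P S \is a fin_num by exact: fin_num_measure.
    have := @measureU _ _ _ P (A `&` h @^-1` C) (~` A `&` h @^-1` C).
    rewrite -setIUl setUCr setTI => /(_ _ _ _)/wrap[].
    - exact: measurableI.
    - by apply: measurableI => //; exact: measurableC.
    - by rewrite setIACA setICr set0I.
    move=> e; have {}e := etrans e (congr1 (fun z => z + _)%E indA).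
    have f1 := fA _ mA; have f2 := fA _ mhC.
    have f3 := fA _ (measurableI _ _ (measurableC mA) mhC).
    rewrite [P (~` A)]probability_setC//.
    have aux (x y z : \bar R) : x \is a fin_num -> y \is a fin_num ->
        z \is a fin_num -> y = (x * y + z)%E -> z = ((1 - x) * y)%E.
      case: x => // x; case: y => // y; case: z => // z _ _ _.
      by rewrite -EFinM -!EFinD -EFinM => -[e']; congr EFin; lra.
    exact: aux f1 f2 f3 e.
  have dis (S : set Omega) : S `<=` setT -> (A `&` S) `&` (if 0 \in B then ~` A else set0) = set0.
    by move=> _; case: ifP => _; rewrite ?setI0// setIAC setICr set0I.
  rewrite GE setIUl !measureU//.
  - have iBC := ind B C mB mC; rewrite setIA in iBC.
    have sC : P ((if 0 \in B then ~` A else set0) `&` h @^-1` C) =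
        (P (if 0%R \in B then ~` A else set0) * P (h @^-1` C))%E.
      by case: ifP => _; [exact: indAc|rewrite set0I measure0 mul0e].
    apply: etrans (esym (ge0_muleDl _ _ _)); [|exact: measure_ge0|exact: measure_ge0].
    exact: (f_equal2 _ iBC sC).
  - exact: measurableI.
  - by case: ifP => // _; exact: measurableC.
  - exact: dis.
  - by apply: measurableI => //; exact: measurableI.
  - by apply: measurableI => //; case: ifP => // _; exact: measurableC.
  - by rewrite setIACA dis// set0I.
have mGh : measurable_fun setT (fun w => (G w, h w)) by exact: measurable_fun_pair.
pose X12 : {mfun Omega >-> (R * R)%type} :=
  HB.pack (fun w => (G w, h w)) (isMeasurableFun.Build _ _ _ _ _ mGh).
pose m1 := distribution P X1; pose m2 := distribution P X2.
have prodE S : measurable S -> (m1 \x m2)%E S = distribution P X12 S.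
  by apply: product_measure_unique => B C mB mC; exact: PGh.
pose f (z : R * R) := (z.1 * z.2)%:E.
have mf : measurable_fun setT f.
  by apply/measurable_EFinP; apply: measurable_funM; [exact: measurable_fst|exact: measurable_snd].
have i1 : m1.-integrable setT (@EFin R).
  by apply: integrable_pushforward => //; exact: mG.
have i2 : m2.-integrable setT (@EFin R).
  by apply: integrable_pushforward => //; exact: (mh).
(* By Tonelli, the integral of the absolute value is the product of the two absolute first moments,
   both finite. *)
have ifm : (m1 \x m2)%E.-integrable setT f.
  apply/integrable12ltyP => //.
  have fE x y : `|f (x, y)|%E = (`|x%:E| * `|y%:E|)%E by rewrite /f /= normrM EFinM.
  have mabs : measurable_fun setT (fun y : R => `|y%:E|%E).
    by apply: measurableT_comp => //; exact: measurable_int i1.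
  under eq_integral => x _.
    under eq_integral => y _ do rewrite fE.
    rewrite ge0_integralZl//.
    over.
  rewrite ge0_integralZr//; last exact: integral_ge0.
  apply: lte_mul_pinfty.
  - exact: integral_ge0.
  - by rewrite ge0_fin_numE ?integral_ge0//; have /integrableP[] := i1.
  - by have /integrableP[] := i2.
have e12 : (\int[m1 \x m2]_z f z = \int[distribution P X12]_z f z)%E.
  by apply: eq_measure_integral => S mS _; exact: prodE.
have iP : P.-integrable setT (f \o X12).
  apply/integrableP; split; first by apply: measurableT_comp.
  have -> : (\int[P]_w `|(f \o X12) w| = \int[distribution P X12]_z `|f z|)%E.
    by rewrite ge0_integral_distribution//; exact: measurableT_comp.
  have /integrableP[_] := ifm; congr (_ < _)%E.
  by apply: eq_measure_integral => S mS _; exact: prodE.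
have iG' : intg G by [].
have eG : (\int[m1]_x x%:E = (E G)%:E)%E.
  by rewrite integral_distribution// -Rintegral_EFin.
have eh : (\int[m2]_x x%:E = (E h)%:E)%E.
  by rewrite integral_distribution// -Rintegral_EFin.
have key : (\int[P]_w (f \o X12) w = (E G * E h)%:E)%E.
  rewrite -integral_distribution// -e12 -(integral12_prod_meas1 ifm).
  rewrite /fubini_F /f /=.
  under eq_integral => x _.
    under eq_integral => y _ do rewrite EFinM.
    rewrite integralZl// eh; over.
  by rewrite /= integralZr// eG.
by rewrite /Rintegral -[RHS]/(fine (E G * E h)%:E) -key.
Qed.

(* Only finitely valued conditioning variables are needed, as the weights are
   functions of the pattern of shared leaves. *)
Lemma pull_out (F : finType) (b : Omega -> F) (phi : F -> R) A U :
  measurable A -> (forall c, measurable (b @^-1` [set c])) -> intg U ->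
  intg (fun w => \1_A w * (phi (b w) * U w)) /\
  E (fun w => \1_A w * (phi (b w) * U w)) =
  \sum_(c : F) phi c * E (fun w => \1_(A `&` b @^-1` [set c]) w * U w).
Proof.
move=> mA mb iU.
have -> : (fun w => \1_A w * (phi (b w) * U w)) =
    (fun w => \sum_(c : F) phi c * (\1_(A `&` b @^-1` [set c]) w * U w)).
  apply/funext => w; rewrite (bigD1 (b w))//= big1 ?addr0.
    rewrite indicI /= (_ : \1_(b @^-1` [set b w]) w = 1) ?mulr1; last by rewrite indicE mem_set.
    ring.
  move=> c cb; rewrite indicI /= (_ : \1_(b @^-1` [set c]) w = 0); last first.
    by rewrite indicE memNset//= => e; rewrite e eqxx in cb.
  by rewrite mulr0 mul0r mulr0.
have ic c : intg (fun w => phi c * (\1_(A `&` b @^-1` [set c]) w * U w)).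
  by apply: intgZ; apply: intg_indic => //; exact: measurableI.
split; first exact: intg_sum.
rewrite E_sum//; apply: eq_bigr => c _.
by rewrite E_Z//; apply: intg_indic => //; exact: measurableI.
Qed.

Lemma transfer_E (dE : measure_display) (S : measurableType dE) (Z Z' : Omega -> S)
    (phi : S -> R) : measurable_fun setT Z -> measurable_fun setT Z' ->
  identically_distributed P Z Z' -> measurable_fun setT phi ->
  intg (phi \o Z') -> intg (phi \o Z) /\ E (phi \o Z) = E (phi \o Z').
Proof.
move=> mZ mZ' id mphi iZ'.
pose X : {mfun Omega >-> S} := HB.pack Z (isMeasurableFun.Build _ _ _ _ Z mZ).
pose X' : {mfun Omega >-> S} := HB.pack Z' (isMeasurableFun.Build _ _ _ _ Z' mZ').
have e (g : S -> \bar R) : (\int[distribution P X]_y g y = \int[distribution P X']_y g y)%E.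
  by apply: eq_measure_integral => B mB _; exact: id.
have mphi' : measurable_fun setT (EFin \o phi) by exact/measurable_EFinP.
have iZ : intg (phi \o Z).
  apply/integrableP; split.
    by apply/measurable_EFinP; exact: measurableT_comp.
  have /integrableP[_] := iZ'; congr (_ < _)%E.
  have := e (fun y => `|(phi y)%:E|%E).
  by rewrite !ge0_integral_distribution//; exact: measurableT_comp.
split=> //; congr fine.
have := e (EFin \o phi); rewrite !integral_distribution//.
Qed.

End Expectation.

(** * Conditional moments of the noise given the inputs *)

Section Model.
Context {R : realType} {dO : measure_display} {Omega : measurableType dO}.
Variables (P : probability Omega R) (d n : nat).
Variables (X : Omega -> d.-tuple R) (Y : Omega -> R).
Variables (Xs : 'I_n -> Omega -> d.-tuple R) (Ys eps : 'I_n -> Omega -> R).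
Variables (f : d.-tuple R -> R) (sigma : R).
Hypothesis model : regression_model P X Y Xs Ys eps f sigma.

Notation intg U := (P.-integrable setT (EFin \o U)).
Notation E U := (Rintegral P setT U).

Let Z (l : 'I_n) (w : Omega) := (Xs l w, Ys l w).
Definition inputs (w : Omega) := ([tuple Xs i w | i < n], X w).

Let mX : measurable_fun setT X. Proof. by have [] := model_meas model. Qed.
Let mY : measurable_fun setT Y. Proof. by have [] := model_meas model. Qed.
Let mXs l : measurable_fun setT (Xs l).
Proof. by have [] := model_sample_meas model l. Qed.
Let mYs l : measurable_fun setT (Ys l).
Proof. by have [] := model_sample_meas model l. Qed.
Let mZ l : measurable_fun setT (Z l).
Proof. exact: measurable_fun_pair. Qed.
Let mf : measurable_fun setT f := model_f_meas model.

Let measurable_pre (dE : measure_display) (S : measurableType dE) (g : Omega -> S) B :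
  measurable_fun setT g -> measurable B -> measurable (g @^-1` B).
Proof. by move=> mg mB; rewrite -[X in measurable X]setTI; exact: (mg). Qed.

Lemma measurable_inputs : measurable_fun setT inputs.
Proof.
apply: measurable_fun_pair => //; apply/measurable_fun_tnthP => i.
rewrite (_ : _ \o _ = Xs i)//; by apply/funext => w /=; rewrite tnth_mktuple.
Qed.

Lemma measurable_sample : measurable_fun setT (sample Xs Ys).
Proof.
apply/measurable_fun_tnthP => i.
rewrite (_ : _ \o _ = Z i)//; by apply/funext => w /=; rewrite tnth_mktuple.
Qed.

(** Product events in the new input and the sample pairs: the independence of the new input from the
    sample and that of the pairs combine on them. *)
Definition rect (B0 : set (d.-tuple R)) (Es : 'I_n -> set (d.-tuple R * R)) :=
  X @^-1` B0 `&` [set w | forall l, Es l (Xs l w, Ys l w)].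

Let measurable_forall (I : finType) (S : I -> set Omega) :
  (forall i, measurable (S i)) -> measurable [set w | forall i, S i w].
Proof.
move=> mS; rewrite (_ : [set w | _] = \bigcap_(i in [set: I]) S i).
  exact: fin_bigcap_measurable.
by apply/seteqP; split => w h i; [move=> _|]; exact: h.
Qed.

Lemma measurable_rect B0 Es : measurable B0 -> (forall l, measurable (Es l)) ->
  measurable (rect B0 Es).
Proof.
move=> mB0 mE; apply: measurableI; first exact: measurable_pre.
by apply: measurable_forall => l; apply: (measurable_pre (mZ l)).
Qed.

Lemma rect_prob B0 Es : measurable B0 -> (forall l, measurable (Es l)) ->
  P (rect B0 Es) = (P (X @^-1` B0) * \prod_l P (Z l @^-1` Es l))%E.
Proof.
move=> mB0 mE; rewrite /rect.
have -> : [set w | forall l, Es l (Xs l w, Ys l w)] =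
    sample Xs Ys @^-1` [set s | forall l, Es l (tnth s l)].
  apply/seteqP; split => w /= h l; first by rewrite tnth_mktuple; exact: h.
  by have := h l; rewrite tnth_mktuple.
rewrite (model_new_input model); last 2 first.
- by exists B0 => //; rewrite setTI.
- exists [set s | forall l, Es l (tnth s l)]; last by rewrite setTI.
  rewrite (_ : [set s | _] = \bigcap_(l in [set: 'I_n]) (fun s => tnth s l) @^-1` Es l).
    apply: fin_bigcap_measurable => // l _.
    rewrite -[X in measurable X]setTI; exact: (measurable_tnth l).
  by apply/seteqP; split => w h i; [move=> _|]; exact: h.
congr (_ * _)%E.
have -> : sample Xs Ys @^-1` [set s | forall l, Es l (tnth s l)] =
    [set w | forall l, (Z l @^-1` Es l) w].
  apply/seteqP; split => w /= h l; last by rewrite tnth_mktuple; exact: h.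
  by have := h l; rewrite tnth_mktuple.
apply: (model_indep model) => l.
by exists (Es l) => //; rewrite setTI.
Qed.

(* Lifts the constraint on the j-th pair, which is then independent of the
   remaining event. *)
Definition rest (j : 'I_n) (Es : 'I_n -> set (d.-tuple R * R)) l :=
  if l == j then setT else Es l.

Lemma rest_indep j B0 Es F : measurable B0 -> (forall l, measurable (Es l)) ->
  measurable F -> P (rect B0 (rest j Es) `&` Z j @^-1` F) =
  (P (rect B0 (rest j Es)) * P (Z j @^-1` F))%E.
Proof.
move=> mB0 mE mF.
have -> : rect B0 (rest j Es) `&` Z j @^-1` F =
    rect B0 (fun l => if l == j then F else Es l).
  apply/seteqP; split => w; rewrite /rect /rest /=.
    move=> [[h0 h1] h2]; split => // l; have := h1 l; case: eqP => // -> _.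
    exact: h2.
  move=> [h0 h1]; split; last by have := h1 j; rewrite eqxx.
  by split => // l; have := h1 l; case: eqP.
rewrite !rect_prob//; first last.
- by move=> l; case: eqP.
- by move=> l; rewrite /rest; case: eqP.
rewrite (bigD1 j)//= [in RHS](bigD1 j)//= /rest !eqxx preimage_setT probability_setT mul1e.
rewrite -muleA; congr (_ * _)%E; rewrite [RHS]muleC; congr (_ * _)%E.
by apply: eq_bigr => l /negPf ->.
Qed.

(** The responses are left free: rectangles of this kind generate the information carried by
    [inputs]. *)
Definition cyl (Bs : 'I_n -> set (d.-tuple R)) l : set (d.-tuple R * R) :=
  Bs l `*` setT.

Lemma measurable_cyl Bs l : (forall l, measurable (Bs l)) -> measurable (cyl Bs l).
Proof. by move=> mB; apply: measurableX. Qed.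

Let measurable_indic_fst (B : set (d.-tuple R)) (psi : d.-tuple R * R -> R) :
  measurable B -> measurable_fun setT psi ->
  measurable_fun setT (fun z => \1_B z.1 * psi z).
Proof.
move=> mB mpsi; apply: measurable_funM => //.
have : measurable_fun setT ((\1_B : d.-tuple R -> R) \o (@fst _ R)).
  by apply: measurableT_comp => //; exact: measurable_indic.
by [].
Qed.

(** The constraint on the [j]-th input is moved into [psi]; the remaining event and [g] are then
    independent of the [j]-th pair, and the expectation factorizes with a zero factor. The last
    hypothesis says that, on that event, [g] does not involve the [j]-th pair; it is met by the
    constant 1 and by the noise of another pair. *)
Lemma rect_zero j (psi : d.-tuple R * R -> R) (g : Omega -> R) B0 Bs :
  measurable B0 -> (forall l, measurable (Bs l)) ->
  measurable_fun setT psi -> intg (psi \o Z j) ->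
  (forall B, measurable B -> E (fun w => \1_B (Xs j w) * psi (Z j w)) = 0) ->
  intg g ->
  (forall C : set R, measurable C -> exists B0' Es', [/\ measurable B0',
     forall l, measurable (Es' l) &
     rect B0 (rest j (cyl Bs)) `&` g @^-1` C = rect B0' (rest j Es')]) ->
  E (fun w => \1_(rect B0 (cyl Bs)) w * (g w * psi (Z j w))) = 0.
Proof.
move=> mB0 mBs mpsi ipsi zpsi ig hg.
pose hh (z : d.-tuple R * R) := \1_(Bs j) z.1 * psi z.
have mhh : measurable_fun setT hh.
  exact: measurable_indic_fst.
have mrest : measurable (rect B0 (rest j (cyl Bs))).
  by apply: measurable_rect => // l; rewrite /rest; case: eqP => // _; exact: measurable_cyl.
have -> : (fun w => \1_(rect B0 (cyl Bs)) w * (g w * psi (Z j w))) =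
    (fun w => \1_(rect B0 (rest j (cyl Bs))) w * g w * (hh \o Z j) w).
  apply/funext => w; rewrite /hh /=.
  have -> : \1_(rect B0 (cyl Bs)) w =
      \1_(rect B0 (rest j (cyl Bs))) w * \1_(Bs j) (Xs j w) :> R.
    rewrite !indicE -natrM mulnb; congr (nat_of_bool _)%:R.
    apply/idP/andP.
      move=> /set_mem[h0 h1]; split; last by apply/mem_set; have [] := h1 j.
      by apply/mem_set; split => // l; rewrite /rest; case: eqP.
    move=> [/set_mem[h0 h1] /set_mem h2]; apply/mem_set; split => // l.
    by have := h1 l; rewrite /rest; case: eqP => [->|].
  by ring.
rewrite (@E_indep _ _ _ P _ g)//; last 4 first.
- exact: intg_measurable ig.
- apply: (intg_le _ ipsi); first exact: measurableT_comp.
  move=> w; rewrite /hh /= normrM indicE.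
  by case: (_ \in _); rewrite ?normr1 ?normr0 ?mul1r ?mul0r.
- exact: intg_indic.
- move=> B C mB mC.
  have [B0' [Es' [mB0' mE' e]]] := hg B mB.
  rewrite setIA e; have -> : (hh \o Z j) @^-1` C = Z j @^-1` (hh @^-1` C) by [].
  apply: rest_indep => //.
  by rewrite -[X in measurable X]setTI; exact: (mhh).
by rewrite /hh /= zpsi ?mulr0.
Qed.

(** At a sample pair this is the error [eps] of the model; its conditional moments are derived from
    those of the generic pair. *)
Definition noise (z : d.-tuple R * R) := z.2 - f z.1.

Lemma measurable_noise : measurable_fun setT noise.
Proof.
apply: measurable_funB; first exact: measurable_snd.
by apply: measurableT_comp => //; exact: measurable_fst.
Qed.

Let XY w := (X w, Y w).

Let intg_noiseXY : intg (noise \o XY).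
Proof.
have [iY ifX _ _] := model_f model.
have -> : noise \o XY = (fun w => Y w + -1 * f (X w)).
  by apply/funext => w; rewrite /noise /=; ring.
by apply: intgD => //; exact: intgZ.
Qed.

Let intg_noise2XY : intg ((fun z => noise z ^+ 2) \o XY).
Proof. by have [] := model_var model. Qed.

(** The moment hypotheses concern [(X, Y)], the predictor uses the sample; equality of laws links
    them. *)
Lemma transfer_XY (psi : d.-tuple R * R -> R) j : measurable_fun setT psi ->
  intg (psi \o XY) -> intg (psi \o Z j) /\ E (psi \o Z j) = E (psi \o XY).
Proof.
move=> mpsi ipsi; apply: transfer_E => //; first exact: measurable_fun_pair.
exact: (model_copies model j).
Qed.

Lemma intg_noise j : intg (noise \o Z j).
Proof. by have [] := transfer_XY j measurable_noise intg_noiseXY. Qed.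

Lemma measurable_noise2 : measurable_fun setT (fun z => noise z ^+ 2).
Proof. by apply: measurable_funX; exact: measurable_noise. Qed.

Lemma intg_noise2 j : intg ((fun z => noise z ^+ 2) \o Z j).
Proof. by have [] := transfer_XY j measurable_noise2 intg_noise2XY. Qed.

Let sigma_genX B : measurable B -> sigma_gen X (X @^-1` B).
Proof. by move=> mB; exists B => //; rewrite setTI. Qed.

Lemma zero_transfer (psi : d.-tuple R * R -> R) j B : measurable_fun setT psi ->
  intg (psi \o XY) -> measurable B ->
  E (fun w => \1_(X @^-1` B) w * psi (XY w)) = 0 ->
  E (fun w => \1_B (Xs j w) * psi (Z j w)) = 0.
Proof.
move=> mpsi ipsi mB h.
have := @transfer_XY (fun z => \1_B z.1 * psi z) j.
case.
- exact: measurable_indic_fst.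
- apply: (@intg_indic _ _ _ P (X @^-1` B) (psi \o XY)) => //; exact: measurable_pre.
by move=> _ ->.
Qed.

Lemma noise_zero j B : measurable B ->
  E (fun w => \1_B (Xs j w) * noise (Z j w)) = 0.
Proof.
move=> mB; apply: zero_transfer => //; first exact: measurable_noise.
have [iY ifX _ eqf] := model_f model.
have mA : measurable (X @^-1` B) by exact: measurable_pre.
have -> : (fun w => \1_(X @^-1` B) w * noise (XY w)) =
   (fun w => \1_(X @^-1` B) w * Y w + -1 * (\1_(X @^-1` B) w * f (X w))).
  by apply/funext => w; rewrite /noise /=; ring.
rewrite E_D ?E_Z//; try exact: intg_indic; last by apply: intgZ; exact: intg_indic.
rewrite !E_restrict; have := eqf _ (sigma_genX mB).
rewrite !Rintegral_EFin// => -[->]; ring.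
Qed.

(** Centring turns the conditional variance into one more vanishing expectation, accessible to the
    same argument as the noise. *)
Definition noise_var (z : d.-tuple R * R) := noise z ^+ 2 + -1 * sigma ^+ 2.

Lemma measurable_noise_var : measurable_fun setT noise_var.
Proof. by apply: measurable_funD => //; exact: measurable_noise2. Qed.

Lemma noise_var_zero j B : measurable B ->
  E (fun w => \1_B (Xs j w) * noise_var (Z j w)) = 0.
Proof.
move=> mB; apply: zero_transfer => //; first exact: measurable_noise_var.
  by apply: (intgD intg_noise2XY); exact: intg_cst.
have [iY ifX _ eqf] := model_var model.
have mA : measurable (X @^-1` B) by exact: measurable_pre.
have -> : (fun w => \1_(X @^-1` B) w * noise_var (XY w)) =
   (fun w => \1_(X @^-1` B) w * (Y w - f (X w)) ^+ 2 + -1 * (\1_(X @^-1` B) w * sigma ^+ 2)).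
  by apply/funext => w; rewrite /noise_var /noise /=; ring.
rewrite E_D ?E_Z//; try exact: intg_indic; last by apply: intgZ; exact: intg_indic.
rewrite !E_restrict; have := eqf _ (sigma_genX mB).
rewrite !Rintegral_EFin// => -[->]; ring.
Qed.

Definition rects : set (set Omega) := [set A | exists B0 Bs,
  [/\ measurable B0, forall l, measurable (Bs l) & A = rect B0 (cyl Bs)]].

Lemma rects_setI : setI_closed rects.
Proof.
move=> _ _ [B0 [Bs [mB0 mBs ->]]] [C0 [Cs [mC0 mCs ->]]].
exists (B0 `&` C0), (fun l => Bs l `&` Cs l); split.
- exact: measurableI.
- by move=> l; exact: measurableI.
apply/seteqP; split => w /=.
  move=> [[h0 h1] [h2 h3]]; split => // l.
  by have [h4 _] := h1 l; have [h5 _] := h3 l.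
by move=> [[h0 h0'] h1]; split; split => // l; have [[h2 h3] _] := h1 l.
Qed.

Lemma rects_measurable : rects `<=` measurable.
Proof.
by move=> _ [B0 [Bs [mB0 mBs ->]]]; apply: measurable_rect => // l; exact: measurable_cyl.
Qed.

Lemma rects_setT : rects setT.
Proof.
exists setT, (fun=> setT); split => //.
by apply/seteqP; split.
Qed.

(** With the sigma-algebra generated by [rects] on the sample space, every component of [inputs] is
    measurable, hence so is [inputs]. *)
Lemma sigma_gen_inputs : sigma_gen inputs `<=` <<s rects >>.
Proof.
pose T1 := g_sigma_algebraType rects.
have mX' : measurable_fun [set: T1] (X : T1 -> _).
  move=> _ B mB; apply: sub_sigma_algebra; exists B, (fun=> setT); split => //.
  by apply/seteqP; split => w /=; [move=> [_ h]|move=> [h _]].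
have mXs' l : measurable_fun [set: T1] (Xs l : T1 -> _).
  move=> _ B mB; apply: sub_sigma_algebra.
  exists setT, (fun l' => if l' == l then B else setT); split => //.
    by move=> l'; case: eqP.
  apply/seteqP; split => w /=.
    by move=> [_ h]; split => // l'; split => //=; case: eqP => // ->.
  by move=> [_ h]; split => //; have [/=] := h l; rewrite eqxx.
have m1 : measurable_fun [set: T1] (inputs : T1 -> _).
  apply: measurable_fun_pair => //; apply/measurable_fun_tnthP => i.
  rewrite (_ : _ \o _ = Xs i)//; by apply/funext => w /=; rewrite tnth_mktuple.
by move=> _ [B mB <-]; exact: (m1).
Qed.

Lemma rects_zero W : intg W ->
  (forall B0 Bs, measurable B0 -> (forall l, measurable (Bs l)) ->
    E (fun w => \1_(rect B0 (cyl Bs)) w * W w) = 0) ->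
  forall A, sigma_gen inputs A -> E (fun w => \1_A w * W w) = 0.
Proof.
move=> iW h A /sigma_gen_inputs; apply: pi_lambda_zero => //.
- exact: rects_setI.
- exact: rects_measurable.
- exact: rects_setT.
- by move=> _ [B0 [Bs [mB0 mBs ->]]]; exact: h.
Qed.

Lemma rest_cst1 j B0 Bs (C : set R) : measurable B0 -> (forall l, measurable (Bs l)) ->
  exists B0' Es', [/\ measurable B0', forall l, measurable (Es' l) &
     rect B0 (rest j (cyl Bs)) `&` (cst 1) @^-1` C = rect B0' (rest j Es')].
Proof.
move=> mB0 mBs; exists (if 1 \in C then B0 else set0), (cyl Bs); split.
- by case: ifP.
- by move=> l; exact: measurable_cyl.
rewrite preimage_cst; case: ifP => _; first by rewrite setIT.
by rewrite setI0 /rect preimage_set0 set0I.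
Qed.

Lemma cond_noise j A : sigma_gen inputs A ->
  E (fun w => \1_A w * noise (Z j w)) = 0.
Proof.
apply: rects_zero; first exact: intg_noise.
move=> B0 Bs mB0 mBs.
have := @rect_zero j noise (cst 1) B0 Bs mB0 mBs measurable_noise (intg_noise j)
  (noise_zero j) (intg_cst P 1) (fun C _ => rest_cst1 j C mB0 mBs).
by under [X in Rintegral _ _ X]funext do rewrite /= mul1r.
Qed.

Lemma cond_noise_var j A : sigma_gen inputs A ->
  E (fun w => \1_A w * noise_var (Z j w)) = 0.
Proof.
have i2 : intg (noise_var \o Z j).
  by apply: (intgD (intg_noise2 j)); exact: intg_cst.
apply: rects_zero; first exact: i2.
move=> B0 Bs mB0 mBs.
have := @rect_zero j noise_var (cst 1) B0 Bs mB0 mBs measurable_noise_var i2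
  (noise_var_zero j) (intg_cst P 1) (fun C _ => rest_cst1 j C mB0 mBs).
by under [X in Rintegral _ _ X]funext do rewrite /= mul1r.
Qed.

Lemma intg_noise_mul i j : intg (fun w => noise (Z i w) * noise (Z j w)).
Proof.
apply: (intg_le _ (intgD (intg_noise2 i) (intg_noise2 j))).
  by apply: measurable_funM; apply: measurableT_comp => //; exact: measurable_noise.
move=> w /=; set a := noise _; set b := noise _.
rewrite [leRHS]ger0_norm ?addr_ge0 ?sqr_ge0// normrM.
have := sqr_ge0 (`|a| - `|b|); rewrite -(real_normK (num_real a)) -(real_normK (num_real b)).
have := sqr_ge0 (`|a| + `|b|); nra.
Qed.

(** [rect_zero] with the noise of pair [i] as [g]: constraining that noise only shrinks the [i]-th
    factor of the rectangle and leaves pair [j] free. *)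
Lemma cond_noise_mul i j A : i != j -> sigma_gen inputs A ->
  E (fun w => \1_A w * (noise (Z i w) * noise (Z j w))) = 0.
Proof.
move=> ij; apply: rects_zero; first exact: intg_noise_mul.
move=> B0 Bs mB0 mBs.
apply: (@rect_zero j noise (noise \o Z i)) => //.
- exact: measurable_noise.
- exact: intg_noise.
- exact: noise_zero.
- exact: intg_noise.
move=> C mC; exists B0, (fun l => if l == i then cyl Bs l `&` noise @^-1` C else cyl Bs l).
split => //.
  move=> l; case: eqP => _; last exact: measurable_cyl.
  apply: measurableI; first exact: measurable_cyl.
  by rewrite -[X in measurable X]setTI; exact: (measurable_noise).
apply/seteqP; split => w /=.
  move=> [[h0 h1] h2]; split => // l; have := h1 l; rewrite /rest.
  by case: eqP => // _; case: eqP => // ->.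
move=> [h0 h1]; split.
  split => // l; have := h1 l; rewrite /rest; case: eqP => // _.
  by case: eqP => // _ [].
by have := h1 i; rewrite /rest (negPf ij) eqxx => -[].
Qed.

End Model.

(** * The error of the forest predictor *)

Section Pattern.
Context {R : realType} {d n K : nat}.

Lemma measurable_in_itv01 (I : R * R) : measurable [set x : R | in_itv01 I x].
Proof.
have -> : [set x : R | in_itv01 I x] =
    [set` `[I.1, +oo[] `&` ([set` `]-oo, I.2[] `|` (if I.2 == 1 then [set 1] else set0)).
  apply/seteqP; split => x; rewrite /in_itv01 /= !in_itv /= andbT.
    by move=> /andP[-> /orP[->|/andP[-> /eqP ->]]]; split => //; [left|right].
  by case: eqP => _ [-> [->|]] //= ->; rewrite eqxx orbT.
apply: measurableI => //; apply: measurableU => //.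
by case: eqP => _; [exact: measurable_set1|exact: measurable0].
Qed.

Lemma measurable_in_box (B : box R d) : measurable [set x : d.-tuple R | in_box B x].
Proof.
have -> : [set x : d.-tuple R | in_box B x] =
    \bigcap_(j in [set: 'I_d]) (fun x => tnth x j) @^-1` [set r | in_itv01 (B j) r].
  apply/seteqP; split => x /=; first by move=> /forallP h j _; exact: h.
  by move=> h; apply/forallP => j; exact: (h j Logic.I).
apply: fin_bigcap_measurable => // j _; rewrite -[X in measurable X]setTI.
by apply: (measurable_tnth j) => //; exact: measurable_in_itv01.
Qed.

Lemma measurable_same_leaf (t : ctree d K) (i : 'I_n) :
  measurable [set z : n.-tuple (d.-tuple R) * d.-tuple R |
    same_leaf t z.2 (tnth z.1 i)].
Proof.
rewrite /same_leaf; elim: (leaves t (unit_box R d)) => [|B s IH] /=.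
  by rewrite (_ : [set _ | _] = set0)//; apply/seteqP; split.
have -> : [set z : n.-tuple (d.-tuple R) * d.-tuple R |
      (in_box B z.2 && in_box B (tnth z.1 i)) ||
      has (fun B0 => in_box B0 z.2 && in_box B0 (tnth z.1 i)) s] =
    (snd @^-1` [set x | in_box B x] `&`
     ((fun u => tnth u i) \o fst) @^-1` [set x | in_box B x]) `|`
    [set z | has (fun B0 => in_box B0 z.2 && in_box B0 (tnth z.1 i)) s].
  apply/seteqP; split => z /=.
    by move=> /orP[/andP[]|]; [left|right].
  by move=> [[-> ->]|->]; rewrite ?orbT.
apply: measurableU IH; apply: measurableI; rewrite -[X in measurable X]setTI.
  by apply: measurable_snd => //; exact: measurable_in_box.
have m : measurable_fun setT ((fun u : n.-tuple (d.-tuple R) => tnth u i) \o (@fst _ (d.-tuple R))).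
  by apply: measurableT_comp => //; exact: measurable_tnth.
by apply: m => //; exact: measurable_in_box.
Qed.

(** All trees are recorded at once, so that the average over trees remains a function of one
    finitely valued variable. *)
Definition pattern_of (z : n.-tuple (d.-tuple R) * d.-tuple R) :
  {ffun ctree d K * 'I_n -> bool} :=
  [ffun q => same_leaf q.1 z.2 (tnth z.1 q.2)].

Lemma measurable_pattern_of c : measurable (pattern_of @^-1` [set c]).
Proof.
have -> : pattern_of @^-1` [set c] = \bigcap_(q in [set: ctree d K * 'I_n])
    [set z | same_leaf q.1 z.2 (tnth z.1 q.2) = c q].
  apply/seteqP; split => z /=; first by move=> <- q _ /=; rewrite ffunE.
  by move=> h; apply/ffunP => q; rewrite ffunE; exact: (h q Logic.I).
apply: fin_bigcap_measurable => // q _.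
have m := measurable_same_leaf q.1 q.2.
case: (c q); first exact: m.
rewrite (_ : [set _ | _] = ~` [set z | same_leaf q.1 z.2 (tnth z.1 q.2)]).
  exact: measurableC.
by apply/seteqP; split => z /=; [move=> ->|move=> /negP /negPf].
Qed.

(** Since the inverse of 0 is 0, an empty leaf gives weight 0 without a case distinction. *)
Definition tree_weight (t : ctree d K) (c : {ffun ctree d K * 'I_n -> bool})
    (i : 'I_n) : R :=
  (c (t, i))%:R / (\sum_(l < n) c (t, l))%N%:R.

Lemma weightE (t : ctree d K) x xs i :
  weight t x (fun l => tnth xs l) i = tree_weight t (pattern_of (xs, x)) i.
Proof.
rewrite /weight /tree_weight /leaf_count.
under [in RHS]eq_bigr do rewrite ffunE /=.
rewrite ffunE /=; case: eqP => // ->; by rewrite invr0 mulr0.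
Qed.

Lemma measurable_finval (dS : measure_display) (S : measurableType dS) (F : finType)
    (b : S -> F) (phi : F -> R) :
  (forall c, measurable (b @^-1` [set c])) -> measurable_fun setT (phi \o b).
Proof.
move=> mb _ B mB; rewrite setTI.
have -> : (phi \o b) @^-1` B = \bigcup_(c in [set c | B (phi c)]) b @^-1` [set c].
  apply/seteqP; split => x /=; first by move=> h; exists (b x).
  by move=> [c /= Bc ->].
by apply: fin_bigcup_measurable => // c _; exact: mb.
Qed.

End Pattern.

(** * Identification of the averaged weights, of the mean and of the squared error *)

Section Forest.
Context {R : realType} {dO : measure_display} {Omega : measurableType dO}.
Variables (P : probability Omega R) (d n K : nat).
Variables (X : Omega -> d.-tuple R) (Y : Omega -> R).
Variables (Xs : 'I_n -> Omega -> d.-tuple R) (Ys eps : 'I_n -> Omega -> R).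
Variables (f : d.-tuple R -> R) (sigma : R).
Variables (p : 'I_d -> R) (Theta : Omega -> ctree d K).
Variables (EW : 'I_n -> Omega -> R) (Ybar : Omega -> R).
Hypothesis model : regression_model P X Y Xs Ys eps f sigma.
Hypothesis forest : centered_forest P X Xs Ys p Theta.
Hypothesis weights : forest_weights P X Xs Ys Theta EW.
Hypothesis mean : forest_mean P X Xs (forest_predictor Ys EW) Ybar.

Notation intg U := (P.-integrable setT (EFin \o U)).
Notation E U := (Rintegral P setT U).
Notation sig := {ffun ctree d K * 'I_n -> bool}.

Notation pat := (@pattern_of R d n K).

Definition pattern (w : Omega) : sig := pattern_of (inputs X Xs w).

Definition avg_weight (i : 'I_n) (c : sig) : R :=
  \sum_(t : ctree d K) ctree_prob p t * tree_weight t c i.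

Definition wgt i w := avg_weight i (pattern w).

Let noise_ i w := noise f (Xs i w, Ys i w).

Lemma measurable_pattern c : measurable (pattern @^-1` [set c]).
Proof.
rewrite -[X in measurable X]setTI.
exact: (measurable_inputs model) (measurable_pattern_of c).
Qed.

Lemma pattern_sigma A c : sigma_gen (inputs X Xs) A ->
  sigma_gen (inputs X Xs) (A `&` pattern @^-1` [set c]).
Proof.
move=> [B mB <-]; exists (B `&` pattern_of @^-1` [set c]).
  by apply: measurableI => //; exact: measurable_pattern_of.
by rewrite !setTI.
Qed.

Lemma sigma_measurable A : sigma_gen (inputs X Xs) A -> measurable A.
Proof. by move=> [B mB <-]; exact: (measurable_inputs model). Qed.

Let XS w := (X w, sample Xs Ys w).

(** [EW] is conditioned on the whole sample, responses included. Discarding the responses shows that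
    the pattern is measurable for this larger sigma-algebra. *)
Let unpair (z : d.-tuple R * n.-tuple (d.-tuple R * R)) :=
  ([tuple (tnth z.2 i).1 | i < n], z.1).

Let unpairE w : unpair (XS w) = inputs X Xs w.
Proof.
rewrite /unpair /inputs /=; congr (_, _); apply/eq_from_tnth => i.
by rewrite !tnth_mktuple.
Qed.

Let measurable_unpair : measurable_fun setT unpair.
Proof.
apply: measurable_fun_pair => //; apply/measurable_fun_tnthP => i.
rewrite (_ : _ \o _ = fst \o (fun u : n.-tuple (d.-tuple R * R) => tnth u i) \o snd).
  apply: measurableT_comp; last exact: measurable_snd.
  apply: measurableT_comp => //; exact: measurable_tnth.
by apply/funext => z /=; rewrite tnth_mktuple.
Qed.

Let measurable_XS : measurable_fun setT XS.
Proof.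
apply: measurable_fun_pair; last exact: (measurable_sample model).
by have [] := model_meas model.
Qed.

Let measurable_unpair_pattern c : measurable ((pat \o unpair) @^-1` [set c]).
Proof.
rewrite -[X in measurable X]setTI.
have -> : (pat \o unpair) @^-1` [set c] = unpair @^-1` (pat @^-1` [set c]) by [].
by apply: measurable_unpair => //; exact: measurable_pattern_of.
Qed.

Lemma pattern_intg (phi : sig -> R) : intg (fun w => phi (pattern w)).
Proof.
apply: (@intg_bounded _ _ _ P _ (\sum_(c : sig) `|phi c|)).
  exact: measurable_finval measurable_pattern.
by move=> w; rewrite (bigD1 (pattern w))//= lerDl sumr_ge0.
Qed.

(** [E_indep] for the event that [Theta] equals [t], with the constant 1 as [g]. *)
Lemma E_Theta A t (phi : sig -> R) : sigma_gen XS A ->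
  E (fun w => \1_(Theta @^-1` [set t]) w * (\1_A w * phi (pattern w))) =
  ctree_prob p t * E (fun w => \1_A w * phi (pattern w)).
Proof.
move=> [B mB AE]; have mA : measurable A by rewrite -AE; exact: (measurable_XS).
have mT : measurable (Theta @^-1` [set t]).
  by apply: (forest_meas forest); exists [set t] => //; rewrite setTI.
have ih : intg (fun w => \1_A w * phi (pattern w)).
  by apply: intg_indic => //; exact: pattern_intg.
have i1 : intg (fun w => \1_(Theta @^-1` [set t]) w * cst 1 w).
  by apply: intg_indic => //; exact: intg_cst.
have := @E_indep _ _ _ P _ (cst 1) _ mT _ ih i1.
under [X in Rintegral _ _ X = _]funext do rewrite /= mulr1.
under [X in Rintegral _ _ X * _]funext do rewrite /= mulr1.
rewrite E_indic// (forest_law forest) /=; apply; first exact: measurable_cst.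
move=> C1 C2 mC1 mC2; rewrite preimage_cst; case: ifP => _; last first.
  by rewrite set0I setI0 measure0 mul0e.
rewrite setTI setIT; apply: (forest_indep forest).
  by exists [set t] => //; rewrite setTI.
pose hh z := \1_B z * phi ((pat \o unpair) z).
exists (hh @^-1` C2).
  rewrite -[X in measurable X]setTI.
  have : measurable_fun setT hh.
    apply: measurable_funM; first exact: measurable_indic.
    exact: measurable_finval measurable_unpair_pattern.
  by apply.
rewrite setTI; apply/seteqP; split => w; rewrite /= /hh /= unpairE -/(pattern w);
  by rewrite -AE setTI !indicE.
Qed.

(** [wgt i] is measurable for the conditioning sigma-algebra, and splitting on the finitely many
    values of [Theta] shows that it has the same integrals as the weight; uniqueness concludes. *)
Lemma weight_ae i : {ae P, forall w, EW i w = wgt i w}.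
Proof.
have [iW iEW mEW eqW] := weights i.
have iw : intg (wgt i) by exact: pattern_intg.
have gm A : sigma_gen XS A -> measurable A by move=> [B mB <-]; exact: (measurable_XS).
apply: (@cond_exp_unique _ _ _ P (sigma_gen XS)) => //.
- exact/sigma_algebra_preimage/sigma_algebra_measurable.
- move=> B mB; exists ((avg_weight i \o (pat \o unpair)) @^-1` B).
    rewrite -[X in measurable X]setTI.
    by apply: (measurable_finval _ measurable_unpair_pattern).
  by rewrite setTI; apply/seteqP; split => w; rewrite /= unpairE.
move=> A GA; have mA := gm _ GA.
have := eqW _ GA; rewrite (Rintegral_EFin mA iEW) (Rintegral_EFin mA iW) => -[e].
rewrite [LHS]E_restrict e -E_restrict => {e}.
have -> : (fun w => \1_A w * weight (Theta w) (X w) (Xs^~ w) i) =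
    (fun w => \sum_(t : ctree d K) \1_(Theta @^-1` [set t]) w *
       (\1_A w * tree_weight t (pattern w) i)).
  apply/funext => w; rewrite (bigD1 (Theta w))//= big1 ?addr0.
    rewrite (_ : \1_(Theta @^-1` [set Theta w]) w = 1 :> R) ?mul1r; last by rewrite indicE mem_set.
    congr (_ * _); rewrite -weightE.
    by congr weight; apply/funext => l; rewrite tnth_mktuple.
  move=> t /eqP tT; rewrite indicE memNset ?mul0r//= => e; by apply: tT.
have it t : intg (fun w => \1_A w * tree_weight t (pattern w) i).
  by apply: intg_indic => //; exact: (pattern_intg (fun c => tree_weight t c i)).
rewrite E_sum; last first.
  move=> t _; apply: intg_indic => //.
  by apply: (forest_meas forest); exists [set t] => //; rewrite setTI.
have -> : (fun w => \1_A w * wgt i w) =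
    (fun w => \sum_(t : ctree d K) ctree_prob p t * (\1_A w * tree_weight t (pattern w) i)).
  apply/funext => w; rewrite /wgt /avg_weight mulr_sumr; apply: eq_bigr => t _.
  by rewrite mulrCA.
rewrite E_sum; last by move=> t _; exact: intgZ.
apply: eq_bigr => t _; rewrite E_Z//.
exact: (E_Theta t (fun c => tree_weight t c i)).
Qed.

Lemma pull_zero (phi : sig -> R) U A : intg U ->
  (forall A, sigma_gen (inputs X Xs) A -> E (fun w => \1_A w * U w) = 0) ->
  sigma_gen (inputs X Xs) A ->
  intg (fun w => \1_A w * (phi (pattern w) * U w)) /\
  E (fun w => \1_A w * (phi (pattern w) * U w)) = 0.
Proof.
move=> iU U0 GA.
have [i e] := pull_out phi (sigma_measurable GA) measurable_pattern iU.
split=> //; rewrite e big1// => c _.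
by rewrite U0 ?mulr0//; exact: pattern_sigma.
Qed.

Lemma sigma_genT : sigma_gen (inputs X Xs) setT.
Proof. by exists setT => //; rewrite setTI preimage_setT. Qed.

Lemma pull_intg (phi : sig -> R) U : intg U -> intg (fun w => phi (pattern w) * U w).
Proof.
move=> iU; have [i _] := pull_out phi measurableT measurable_pattern iU.
by move: i; under [X in intg X]funext do rewrite indicT mul1r.
Qed.

Lemma pull_zeroT (phi : sig -> R) U : intg U ->
  (forall A, sigma_gen (inputs X Xs) A -> E (fun w => \1_A w * U w) = 0) ->
  E (fun w => phi (pattern w) * U w) = 0.
Proof.
move=> iU U0; have [_] := pull_zero phi iU U0 sigma_genT.
by under [X in Rintegral _ _ X = _ -> _]funext do rewrite indicT mul1r.
Qed.

Let intg_fXs i : intg (f \o Xs i).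
Proof.
have [iY ifX _ _] := model_f model.
have h : measurable_fun setT (f \o (@fst _ R)).
  by apply: measurableT_comp => //; exact: (model_f_meas model).
by have [] := @transfer_XY _ _ _ P _ _ _ _ _ _ _ _ _ model (f \o fst) i h ifX.
Qed.

Let intg_noise_ i : intg (noise_ i).
Proof. exact: (intg_noise model i). Qed.

Let intg_Ys i : intg (Ys i).
Proof.
have := intgD (intg_fXs i) (intg_noise_ i).
by apply: eq_integrable => // w _; rewrite /= /noise_ /noise /= addrC subrK.
Qed.

(** Once [EW] is replaced by [wgt] almost everywhere, write each response as regression function
    plus noise: the noise terms integrate to 0 over every event of the inputs. *)
Lemma mean_ae : {ae P, forall w, Ybar w = \sum_i wgt i w * f (Xs i w)}.
Proof.
have [iYhat iYbar mYbar eqY] := mean.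
have iwf : intg (fun w => \sum_i wgt i w * f (Xs i w)).
  by apply: intg_sum => i _; exact: (pull_intg (avg_weight i) (intg_fXs i)).
apply: (@cond_exp_unique _ _ _ P (sigma_gen (inputs X Xs))) => //.
- exact/sigma_algebra_preimage/sigma_algebra_measurable.
- by move=> A; exact: sigma_measurable.
- move=> B mB.
  pose g z := \sum_i avg_weight i (pattern_of z) * f (tnth z.1 i).
  exists (g @^-1` B).
    rewrite -[X in measurable X]setTI.
    have : measurable_fun setT g.
      apply: measurable_sum => i; apply: measurable_funM.
        exact: measurable_finval measurable_pattern_of.
      apply: (measurableT_comp (model_f_meas model)).
      have : measurable_fun setT
          ((fun u : n.-tuple (d.-tuple R) => tnth u i) \o (@fst _ (d.-tuple R))).
        by apply: measurableT_comp => //; exact: measurable_tnth.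
      by [].
    by apply.
  have gE w : g (inputs X Xs w) = \sum_i wgt i w * f (Xs i w).
    by apply: eq_bigr => i _; rewrite /inputs /= tnth_mktuple.
  by rewrite setTI; apply/seteqP; split => w; rewrite /= gE.
move=> A GA; have mA := sigma_measurable GA.
have := eqY _ GA; rewrite (Rintegral_EFin mA iYbar) (Rintegral_EFin mA iYhat) => -[e].
rewrite [LHS]E_restrict e -E_restrict => {e}.
have iwY : intg (fun w => \sum_i wgt i w * Ys i w).
  by apply: intg_sum => i _; exact: (pull_intg (avg_weight i) (intg_Ys i)).
transitivity (E (fun w => \1_A w * \sum_i wgt i w * Ys i w)).
  congr fine; apply: eq_ae_E.
  - exact: (intg_measurable (intg_indic mA iYhat)).
  - exact: (intg_measurable (intg_indic mA iwY)).
  have : {ae P, forall w, forall i, EW i w = wgt i w}.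
    by apply: filter_forall => i; exact: weight_ae.
  apply: filterS => w h; congr (_ * _).
  by rewrite /forest_predictor; apply: eq_bigr => i _; rewrite h.
have -> : (fun w => \1_A w * \sum_i wgt i w * Ys i w) =
    (fun w => \1_A w * (\sum_i wgt i w * f (Xs i w))
       + \sum_i \1_A w * (wgt i w * noise_ i w)).
  apply/funext => w; rewrite -mulr_sumr -mulrDr -big_split /=; congr (_ * _).
  by apply: eq_bigr => i _; rewrite /noise_ /noise /=; ring.
have z i : intg (fun w => \1_A w * (wgt i w * noise_ i w)) /\
    E (fun w => \1_A w * (wgt i w * noise_ i w)) = 0.
  apply: (@pull_zero (avg_weight i)) => // A' GA'.
  exact: (cond_noise model i GA').
rewrite E_D; [|exact: intg_indic|by apply: intg_sum => i _; have [] := z i].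
rewrite E_sum; last by move=> i _; have [] := z i.
by rewrite [X in _ + X]big1 ?addr0// => i _; have [] := z i.
Qed.

(** The square is expanded almost everywhere into the double sum [D], integrable because its
    coefficients take finitely many values. Off-diagonal terms vanish by [cond_noise_mul]; on the
    diagonal [cond_noise_var] replaces the squared noise by [sigma ^+ 2]. *)
Lemma mse_eq :
  ('E_P[fun w => ((forest_predictor Ys EW w - Ybar w) ^+ 2)%R] =
  (sigma ^+ 2 * \sum_i E (fun w => wgt i w ^+ 2))%:E)%E.
Proof.
pose D w := \sum_i \sum_j (avg_weight i (pattern w) * avg_weight j (pattern w))
   * (noise_ i w * noise_ j w).
have iD i j : intg (fun w => (avg_weight i (pattern w) * avg_weight j (pattern w))
   * (noise_ i w * noise_ j w)).
  apply: (pull_intg (fun c => avg_weight i c * avg_weight j c)).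
  exact: (intg_noise_mul model i j).
have intD : intg D.
  by apply: intg_sum => i _; apply: intg_sum => j _; exact: iD.
have [iYhat iYbar _ _] := mean.
transitivity (\int[P]_w (D w)%:E)%E.
  rewrite unlock; apply: eq_ae_E.
  - by apply: measurable_funX; apply: measurable_funB;
      [exact: intg_measurable iYhat|exact: intg_measurable iYbar].
  - exact: intg_measurable intD.
  have : {ae P, forall w, forall i, EW i w = wgt i w}.
    by apply: filter_forall => i; exact: weight_ae.
  move=> h1; have h2 := mean_ae; move: h1 h2; apply: filterS2 => w h1 ->.
  rewrite /D /forest_predictor -sumrB expr2 mulr_suml; apply: eq_bigr => i _.
  rewrite mulr_sumr; apply: eq_bigr => j _.
  rewrite !h1 /wgt /noise_ /noise /=; ring.
rewrite (Rintegral_EFin measurableT intD); congr EFin.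
rewrite E_sum; last by move=> i _; apply: intg_sum => j _; exact: iD.
rewrite mulr_sumr; apply: eq_bigr => i _.
rewrite E_sum// (bigD1 i)//= [X in _ + X]big1 ?addr0; last first.
  move=> j ji; apply: (@pull_zeroT (fun c => avg_weight i c * avg_weight j c)).
    exact: (intg_noise_mul model i j).
  by move=> A; apply: (cond_noise_mul model); rewrite eq_sym.
have iv : intg (fun w => noise_var f sigma (Xs i w, Ys i w)).
  by apply: (intgD (intg_noise2 model i)); exact: intg_cst.
have := @pull_zeroT (fun c => avg_weight i c ^+ 2) _ iv (fun A GA => cond_noise_var model i GA).
have -> : (fun w => avg_weight i (pattern w) ^+ 2 * noise_var f sigma (Xs i w, Ys i w)) =
   (fun w => (avg_weight i (pattern w) * avg_weight i (pattern w)) * (noise_ i w * noise_ i w) +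
     - sigma ^+ 2 * (wgt i w ^+ 2)).
  by apply/funext => w; rewrite /noise_var /noise_ /wgt; ring.
have iw : intg (fun w => wgt i w ^+ 2) by exact: (pattern_intg (fun c => avg_weight i c ^+ 2)).
rewrite E_D//; last exact: intgZ.
by rewrite E_Z// mulNr => /eqP; rewrite subr_eq0 => /eqP.
Qed.

End Forest.

(** * Second moments of the averaged weights *)

(** The set lies between [[a, b[] and [[a, b]], which have the same length. *)
Lemma uniform_prob_itv01 {R : realType} (I : R * R) :
  0 <= I.1 -> I.1 < I.2 -> I.2 <= 1 ->
  uniform_prob (@ltr01 R) [set x | in_itv01 I x] = (I.2 - I.1)%:E.
Proof.
case: I => a b /= a0 ab b1.
rewrite /uniform_prob integral_uniform_pdf.
have sub : [set x | in_itv01 (a, b) x] `<=` `[a, b].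
  move=> x; rewrite /in_itv01 /= in_itv /= => /andP[-> /orP[/ltW//|/andP[/eqP -> /eqP ->]]].
  exact: lexx.
have sub01 : [set x | in_itv01 (a, b) x] `<=` `[0, 1].
  move=> x /sub; rewrite /= !in_itv /= => /andP[h1 h2]; apply/andP; split; lra.
rewrite (setIidl sub01).
have mI := measurable_in_itv01 (a, b).
rewrite (eq_integral (cst 1%E)); last first.
  move=> x /set_mem /sub01; rewrite /uniform_pdf /= in_itv /= => ->.
  by rewrite subr0 invr1.
rewrite integral_cst// mul1e.
apply/eqP; rewrite eq_le; apply/andP; split.
  have h : (lebesgue_measure [set x | in_itv01 (a, b) x] <=
      lebesgue_measure ([set` `[a, b]] : set R))%E by apply: le_measure; rewrite ?inE.
  apply: (le_trans h).
  by rewrite lebesgue_measure_itv /= lte_fin ab -EFinD.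
have -> : (b - a)%:E = lebesgue_measure ([set` `[a, b[] : set R).
  by rewrite lebesgue_measure_itv /= lte_fin ab -EFinD.
apply: le_measure; rewrite ?inE//.
by move=> x; rewrite /in_itv01 /= in_itv /= => /andP[-> ->].
Qed.

Section Algebra.
Context {R : realType} {d n K : nat}.
Variable p : 'I_d -> R.
Hypothesis p_ge0 : forall j, 0 <= p j.
Implicit Type c : {ffun ctree d K * 'I_n -> bool}.

Definition conn c (i : 'I_n) : R := \sum_(t : ctree d K) ctree_prob p t * (c (t, i))%:R.

(** The sum over t of P(t) S_ti N_t, which arises when 1 / N_t is bounded below by an affine
    function of N_t. *)
Definition conn_count c (i : 'I_n) : R := \sum_(t : ctree d K)
  ctree_prob p t * ((c (t, i))%:R * \sum_(l < n) (c (t, l))%:R).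

Lemma conn_ge0 c i : 0 <= conn c i.
Proof. by apply: sumr_ge0 => t _; rewrite mulr_ge0// ctree_prob_ge0. Qed.

(* Tangent lines of x^-1 at 1 / b and of x^2 at b * conn c i turn the random
   denominator into a polynomial in the indicators. *)
Lemma avg_weight_sqr_ge c i (b : R) : 0 < b ->
  3 * b ^+ 2 * conn c i ^+ 2 - 2 * b ^+ 3 * (conn c i * conn_count c i) <=
  avg_weight p i c ^+ 2.
Proof.
move=> b0; have c0 := conn_ge0 c i.
have av : 2 * b * conn c i - b ^+ 2 * conn_count c i <= avg_weight p i c.
  rewrite /conn /conn_count /avg_weight !mulr_sumr -sumrB; apply: ler_sum => t _.
  have pt : 0 <= ctree_prob p t by exact: ctree_prob_ge0.
  rewrite /tree_weight natr_sum; set N := \sum_(l < n) _.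
  case ci : (c (t, i)); last by rewrite /= !mul0r !mulr0 subr0.
  have N1 : 1 <= N.
    rewrite /N (bigD1 i)//= ci lerDl; apply: sumr_ge0 => l _; exact: ler0n.
  have h : 2 * b - b ^+ 2 * N <= N^-1.
    rewrite -(ler_pM2r (_ : 0 < N)); last lra.
    rewrite mulVf ?gt_eqF//; last lra.
    by have := sqr_ge0 (b * N - 1); nra.
  have -> : 2 * b * (ctree_prob p t * true%:R) - b ^+ 2 * (ctree_prob p t * (true%:R * N)) =
     ctree_prob p t * (2 * b - b ^+ 2 * N) by rewrite /=; ring.
  by rewrite mul1r ler_wpM2l.
(* The square is at least [2 * b * x * z - b ^+ 2 * x ^+ 2], with [x] the connection and [z] the
   weight. Bounding [z] below by [av] turns the first term into [4 * b ^+ 2 * x ^+ 2] minus the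
   cubic term; the coefficient 3 is 4 - 1. *)
have h1 := sqr_ge0 (avg_weight p i c - b * conn c i).
have h2 : conn c i * (2 * b * conn c i - b ^+ 2 * conn_count c i) <= conn c i * avg_weight p i c.
  by rewrite ler_wpM2l.
have h3 : 2 * b * (conn c i * (2 * b * conn c i - b ^+ 2 * conn_count c i)) <=
   2 * b * (conn c i * avg_weight p i c) by rewrite ler_wpM2l//; lra.
move: h1 h3; set x := conn c i; set y := conn_count c i; set z := avg_weight p i c => h1 h3.
have e1 : (z - b * x) ^+ 2 = z ^+ 2 - 2 * b * (x * z) + b ^+ 2 * x ^+ 2 by ring.
have e2 : 2 * b * (x * (2 * b * x - b ^+ 2 * y)) =
   4 * b ^+ 2 * x ^+ 2 - 2 * b ^+ 3 * (x * y) by ring.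
lra.
Qed.

Lemma sum_sqr_le (I : finType) (a : I -> R) : (forall i, 0 <= a i) ->
  \sum_i a i ^+ 2 <= (\sum_i a i) ^+ 2.
Proof.
move=> a0; rewrite expr2 mulr_suml; apply: ler_sum => i _.
rewrite expr2 ler_wpM2l// (bigD1 i)//= lerDl; exact: sumr_ge0.
Qed.

End Algebra.

Section Lower.
Context {R : realType} {dO : measure_display} {Omega : measurableType dO}.
Variables (P : probability Omega R) (d n K : nat).
Variables (X : Omega -> d.-tuple R) (Y : Omega -> R).
Variables (Xs : 'I_n -> Omega -> d.-tuple R) (Ys eps : 'I_n -> Omega -> R).
Variables (f : d.-tuple R -> R) (sigma : R) (p : 'I_d -> R).
Hypothesis model : regression_model P X Y Xs Ys eps f sigma.
Hypothesis p_ge0 : forall j, 0 <= p j.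
Hypothesis p_sum : \sum_j p j = 1.

Notation intg U := (P.-integrable setT (EFin \o U)).
Notation E U := (Rintegral P setT U).
Notation sig := {ffun ctree d K * 'I_n -> bool}.
Notation pat := (@pattern R _ Omega d n K X Xs).
Notation q := (2 ^- K : R).

Let mX : measurable_fun setT X. Proof. by have [] := model_meas model. Qed.

Let ind (B : box R d) (x : d.-tuple R) : R := (in_box B x)%:R.

Let boxset (B : box R d) : set (d.-tuple R) := [set x | in_box B x].

Lemma box_prob (B : box R d) : good_box B -> P (X @^-1` boxset B) = (box_vol B)%:E.
Proof.
move=> gB; have := model_uniform model (fun j => measurable_in_itv01 (B j)).
have -> : [set w | forall j, [set x | in_itv01 (B j) x] (tnth (X w) j)] = X @^-1` boxset B.
  apply/seteqP; split => w /=; first by move=> h; apply/forallP => j; exact: h.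
  by move=> /forallP h j; exact: h.
move=> ->; rewrite /box_vol -prodEFin; apply: eq_bigr => j _.
by have [h1 h2 h3] := gB j; exact: uniform_prob_itv01.
Qed.

Lemma box_prob_sample (B : box R d) l : good_box B ->
  P ((fun w => (Xs l w, Ys l w)) @^-1` (boxset B `*` setT)) = (box_vol B)%:E.
Proof.
move=> gB; rewrite (model_copies model l); last first.
  by apply: measurableX => //; exact: measurable_in_box.
rewrite -box_prob//; congr (P _); apply/seteqP; split => w /=; [by case|by move=> h].
Qed.

Let evt (F F' : set (d.-tuple R)) (i : 'I_n) : set Omega :=
  rect X Xs Ys F (fun j => if j == i then F' `*` setT else setT).

Let evtE F F' i w : \1_(evt F F' i) w = \1_F (X w) * \1_F' (Xs i w) :> R.
Proof.
rewrite !indicE -natrM mulnb; congr (nat_of_bool _)%:R.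
apply/idP/andP.
  move=> /set_mem[h0 h1]; split; first exact: mem_set.
  by apply: mem_set; have := h1 i; rewrite eqxx => -[].
move=> [/set_mem h0 /set_mem h1]; apply: mem_set; split => // l.
by case: eqP => // ->.
Qed.

Let measurable_evt F F' i : measurable F -> measurable F' -> measurable (evt F F' i).
Proof.
move=> mF mF'; apply: (measurable_rect model) => // l.
by case: eqP => // _; exact: measurableX.
Qed.

Lemma E_evt_box F F' i l (B : box R d) : i != l -> measurable F -> measurable F' ->
  good_box B ->
  E (fun w => \1_(evt F F' i) w * ind B (Xs l w)) = E \1_(evt F F' i) * box_vol B.
Proof.
move=> il mF mF' gB.
have mE := measurable_evt i mF mF'.
have mC : measurable ((fun w => (Xs l w, Ys l w)) @^-1` (boxset B `*` setT)).
  have [h1 h2] := model_sample_meas model l.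
  rewrite -[X in measurable X]setTI; apply: (measurable_fun_pair h1 h2) => //.
  by apply: measurableX => //; exact: measurable_in_box.
have -> : (fun w => \1_(evt F F' i) w * ind B (Xs l w)) =
    \1_(evt F F' i `&` (fun w => (Xs l w, Ys l w)) @^-1` (boxset B `*` setT)).
  apply/funext => w; rewrite indicI /=; congr (_ * _); rewrite indicE /ind.
  congr (nat_of_bool _)%:R; apply/idP/idP; first by move=> h; apply: mem_set.
  by move=> /set_mem[].
rewrite !E_indic//; last exact: measurableI.
pose Es (j : 'I_n) : set (d.-tuple R * R) := if j == i then F' `*` setT else setT.
have mEs j : measurable (Es j) by rewrite /Es; case: eqP => // _; exact: measurableX.
have -> : evt F F' i = rect X Xs Ys F (rest l Es).
  apply/seteqP; split => w [h0 h1]; split => // j; have := h1 j; rewrite /rest /Es.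
    by case: (j == l).
  by have [->|] := eqVneq j l => //; rewrite eq_sym (negPf il).
have mB : measurable (boxset B `*` [set: R]).
  by apply: measurableX => //; exact: measurable_in_box.
rewrite (rest_indep model l mF mEs mB) box_prob_sample// fineM//.
by apply: fin_num_measure; apply: (measurable_rect model) => // j; rewrite /rest; case: eqP.
Qed.

Lemma E_evt_box2 F i (B : box R d) : measurable F -> good_box B ->
  E \1_(evt F (boxset B) i) = fine (P (X @^-1` F)) * box_vol B.
Proof.
move=> mF gB; have mB := measurable_in_box B.
rewrite E_indic; last exact: measurable_evt.
pose Es (j : 'I_n) : set (d.-tuple R * R) := setT.
have mEs j : measurable (Es j) by exact: measurableT.
have mC : measurable (boxset B `*` [set: R]) by exact: measurableX.
have -> : evt F (boxset B) i = rect X Xs Ys F (rest i Es) `&`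
    (fun w => (Xs i w, Ys i w)) @^-1` (boxset B `*` setT).
  apply/seteqP; split => w.
    move=> [h0 h1]; split; first by split => // l; rewrite /rest; case: ifP.
    by have := h1 i; rewrite eqxx.
  by move=> [[h0 _] h1]; split => // l; case: eqP => // ->.
rewrite (rest_indep model i mF mEs mC) box_prob_sample// fineM//; last first.
  by apply: fin_num_measure; apply: (measurable_rect model) => // j; rewrite /rest; case: eqP.
congr (fine (P _) * _); apply/seteqP; split => w; first by case.
by move=> h; split => // l; rewrite /rest; case: ifP.
Qed.

Let S t i w : R := (pat w (t, i))%:R.

Let SE t i w : S t i w = \sum_(B <- leaves t (unit_box R d)) ind B (X w) * ind B (Xs i w).
Proof.
rewrite /S /pattern /pattern_of ffunE /= /inputs /= tnth_mktuple same_leafE /co_leaf natr_sum.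
by apply: eq_bigr => B _; rewrite /ind -natrM mulnb.
Qed.

Let unit_leaves (t : ctree d K) :
  List.Forall (fun B : box R d => good_box B /\ box_vol B = q) (leaves t (unit_box R d)).
Proof.
have := leaves_good t (@good_unit_box R d).
by apply: List.Forall_impl => B [g ->]; rewrite box_vol_unit mul1r.
Qed.

Let intg_pat (phi : sig -> R) : intg (fun w => phi (pat w)).
Proof. exact: (pattern_intg model). Qed.

Let indI B B' x : ind B x * ind B' x = \1_(boxset B `&` boxset B') x.
Proof.
rewrite /ind -natrM mulnb indicE; congr (nat_of_bool _)%:R; apply/andP/idP.
  by move=> [h1 h2]; apply: mem_set.
by move=> /set_mem[].
Qed.

Let ind1 B x : ind B x = \1_(boxset B) x.
Proof.
by rewrite /ind indicE; congr (nat_of_bool _)%:R; apply/idP/idP => [h|/set_mem//]; apply: mem_set.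
Qed.

(** On the event that [X] lies in a given leaf of [t], the factor [S t l] only asks whether the
    [l]-th input is in that leaf, which has probability [q] independently of [X] and the [i]-th
    input. Summing over leaves gives an inequality because a point lies in at most one of them. *)
Lemma E_three u t i l : i != l ->
  E (fun w => S u i w * S t i w * S t l w) <= q * E (fun w => S u i w * S t i w).
Proof.
move=> il; set L := leaves t (unit_box R d); set L' := leaves u (unit_box R d).
pose F (B' B'' : box R d) := boxset B' `&` boxset B''.
have mF B' B'' : measurable (F B' B'') by apply: measurableI; exact: measurable_in_box.
pose A (B B' B'' : box R d) := evt (F B' B'' `&` boxset B) (F B' B'') i.
have mA B B' B'' : measurable (A B B' B'').
  by apply: measurable_evt => //; apply: measurableI => //; exact: measurable_in_box.
have AE B B' B'' w : \1_(A B B' B'') w = ind B' (X w) * ind B'' (X w) * ind B (X w)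
    * (ind B' (Xs i w) * ind B'' (Xs i w)).
  by rewrite evtE indicI /= -indI -indI -ind1.
have ml B : measurable_fun setT (fun w => ind B (Xs l w)).
  have -> : (fun w => ind B (Xs l w)) = \1_(Xs l @^-1` boxset B).
    by apply/funext => w; rewrite ind1.
  apply: measurable_indic; rewrite -[X in measurable X]setTI.
  by have [h1 _] := model_sample_meas model l; apply: h1 => //; exact: measurable_in_box.
have il' B : intg (fun w => ind B (Xs l w)).
  apply: (@intg_bounded _ _ _ P _ 1) => // w.
  by rewrite /ind; case: in_box; rewrite ?normr1 ?normr0.
have iA B B' B'' : intg \1_(A B B' B'').
  have := intg_indic (mA B B' B'') (intg_cst P 1).
  by under [X in intg X -> _]funext do rewrite mulr1.
have -> : (fun w => S u i w * S t i w * S t l w) =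
   (fun w => \sum_(B <- L) \sum_(B' <- L') \sum_(B'' <- L)
      \1_(A B B' B'') w * ind B (Xs l w)).
  apply/funext => w; rewrite !SE mulr_sumr; apply: eq_bigr => B _.
  rewrite -mulrA mulr_suml; apply: eq_bigr => B' _.
  rewrite mulr_suml mulr_sumr; apply: eq_bigr => B'' _.
  by rewrite AE; ring.
have iAl B B' B'' : intg (fun w => \1_(A B B' B'') w * ind B (Xs l w)).
  exact: intg_indic.
rewrite E_sum; last by move=> *; do 2 apply: intg_sum => ? _.
rewrite (big_Forall (unit_leaves t) (G := fun B =>
   q * E (fun w => \sum_(B' <- L') \sum_(B'' <- L) \1_(A B B' B'') w))); last first.
  move=> B [gB vB].
  rewrite E_sum; last by move=> *; apply: intg_sum => ? _.
  rewrite E_sum; last by move=> *; apply: intg_sum => ? _.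
  rewrite mulr_sumr; apply: eq_bigr => B' _.
  rewrite E_sum// E_sum// mulr_sumr; apply: eq_bigr => B'' _.
  rewrite E_evt_box//; first by rewrite vB mulrC.
  by apply: measurableI => //; exact: measurable_in_box.
rewrite -mulr_sumr; apply: ler_wpM2l; first by rewrite invr_ge0 exprn_ge0.
rewrite -E_sum; last by move=> *; do 2 apply: intg_sum => ? _.
apply: E_le.
- by do 3 apply: intg_sum => ? _.
- exact: (intg_pat (fun c => (c (u, i))%:R * (c (t, i))%:R)).
move=> w; have -> : \sum_(B <- L) \sum_(B' <- L') \sum_(B'' <- L) \1_(A B B' B'') w =
    S u i w * S t i w * \sum_(B <- L) ind B (X w).
  rewrite mulr_sumr; apply: eq_bigr => B _.
  rewrite !SE -mulrA mulr_suml; apply: eq_bigr => B' _.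
  rewrite mulr_suml mulr_sumr; apply: eq_bigr => B'' _.
  by rewrite AE; ring.
rewrite ler_piMr// ?mulr_ge0 ?ler0n//.
rewrite /ind -natr_sum -[leRHS]/(1%:R) ler_nat.
exact: leq_trans (sum_in_leaves t (X w) (@good_unit_box R d)) (leq_b1 _).
Qed.

Let C i := E (fun w => conn p (pat w) i ^+ 2).

Lemma conn_sqrE i w : conn p (pat w) i ^+ 2 =
  \sum_(u : ctree d K) \sum_(t : ctree d K)
    ctree_prob p u * ctree_prob p t * (S u i w * S t i w).
Proof.
rewrite expr2 /conn mulr_suml; apply: eq_bigr => u _.
by rewrite mulr_sumr; apply: eq_bigr => t _; rewrite mulrACA.
Qed.

(** In the leaf count, the point [i] itself contributes 1 and each of the [n - 1] others at most
    [q]. *)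
Lemma E_conn_count i : E (fun w => conn p (pat w) i * conn_count p (pat w) i) <=
  (1 + (n%:R - 1) * q) * C i.
Proof.
have iS u t l : intg (fun w => S u i w * S t i w * S t l w).
  exact: (intg_pat (fun c => (c (u, i))%:R * (c (t, i))%:R * (c (t, l))%:R)).
have iS2 u t : intg (fun w => S u i w * S t i w).
  exact: (intg_pat (fun c => (c (u, i))%:R * (c (t, i))%:R)).
have -> : (fun w => conn p (pat w) i * conn_count p (pat w) i) =
   (fun w => \sum_(u : ctree d K) \sum_(t : ctree d K) ctree_prob p u * ctree_prob p t *
     (\sum_(l < n) S u i w * S t i w * S t l w)).
  apply/funext => w; rewrite /conn /conn_count mulr_suml; apply: eq_bigr => u _.
  rewrite mulr_sumr; apply: eq_bigr => t _; rewrite mulrACA -mulr_sumr /S; congr (_ * _).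
  by rewrite mulrA.
rewrite /C; under [X in _ <= _ * Rintegral _ _ X]funext do rewrite conn_sqrE.
rewrite E_sum; last by move=> u _; apply: intg_sum => t _; apply: intgZ; exact: intg_sum.
rewrite E_sum; last by move=> u _; apply: intg_sum => t _; exact: intgZ.
rewrite mulr_sumr; apply: ler_sum => u _.
rewrite E_sum; last by move=> t _; apply: intgZ; exact: intg_sum.
rewrite E_sum; last by move=> t _; exact: intgZ.
rewrite mulr_sumr; apply: ler_sum => t _.
rewrite E_Z; last exact: intg_sum.
rewrite E_Z// mulrCA ler_wpM2l ?mulr_ge0 ?ctree_prob_ge0//.
rewrite E_sum// (bigD1 i)//= mulrDl mul1r; apply: lerD.
  apply: E_le => // w; rewrite /S; case: (pat w (t, i)); rewrite ?mulr1 ?mulr0//.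
apply: (@le_trans _ _ (\sum_(l < n | l != i) q * E (fun w => S u i w * S t i w))).
  by apply: ler_sum => l li; apply: E_three; rewrite eq_sym.
rewrite sumr_const cardC1 card_ord -[leLHS]mulr_natl mulrA.
suff -> : n.-1%:R = n%:R - 1 :> R by [].
by rewrite -[in RHS](prednK (leq_ltn_trans (leq0n i) (ltn_ord i))) -natr1 addrK.
Qed.

(** Realize the event by the tree of [uniform_ctree]: each of its 2^K leaves contains both points
    with probability [q ^+ 2]. *)
Lemma E_agree i (m : {ffun 'I_d -> nat}) : (\sum_j m j)%N = K ->
  E (fun w => (box_agree (unit_box R d) m (X w) (Xs i w))%:R) = q.
Proof.
move=> /(@uniform_ctree R)[t tE].
have -> : (fun w => (box_agree (unit_box R d) m (X w) (Xs i w))%:R) =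
   (fun w => \sum_(B <- leaves t (unit_box R d)) \1_(evt (boxset B) (boxset B) i) w : R).
  apply/funext => w; rewrite -tE natr_sum; apply: eq_bigr => B _.
  by rewrite evtE -!ind1 /ind -natrM mulnb.
rewrite E_sum; last first.
  move=> B _; have mE : measurable (evt (boxset B) (boxset B) i).
    by apply: measurable_evt; exact: measurable_in_box.
  have := intg_indic mE (intg_cst P 1).
  by under [X in intg X -> _]funext do rewrite mulr1.
rewrite (big_Forall (unit_leaves t) (G := fun=> q ^+ 2)); last first.
  move=> B [gB vB]; rewrite E_evt_box2//; last exact: measurable_in_box.
  by rewrite box_prob//= vB.
rewrite big_const_seq count_predT leaves_size iter_addr_0 -[LHS]mulr_natl natrX.
by rewrite expr2 mulrA mulfV ?mul1r// expf_eq0 pnatr_eq0 andbF.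
Qed.

(** Nonnegative cross terms of the squared sum are dropped. Vectors [m] that come from no tree have
    mass 0, so integrability and expectation are only needed on the support. *)
Lemma E_conn_sqr i : q * \sum_(m : {ffun 'I_d -> 'I_K.+1}) multi_pmf p m ^+ 2 <= C i.
Proof.
pose agr (m : {ffun 'I_d -> 'I_K.+1}) w : R :=
  (box_agree (unit_box R d) (nat_ffun m) (X w) (Xs i w))%:R.
have supp (m : {ffun 'I_d -> 'I_K.+1}) : multi_pmf p m != 0 -> (\sum_j nat_ffun m j)%N = K.
  move=> h; apply/eqP; apply: contraTT h => h; rewrite negbK; apply/eqP.
  have hm : ~~ multi_supp p K (nat_ffun m).
    by rewrite /multi_supp negb_and h.
  exact: multi_pmf0 hm.
have connE w : conn p (pat w) i = \sum_m multi_pmf p m * agr m w.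
  rewrite -(multi_expE p K (fun m => (box_agree (unit_box R d) m (X w) (Xs i w))%:R)).
  rewrite -sum_co_leaf//; apply: eq_bigr => t _; congr (_ * _%:R).
  by rewrite /pattern /pattern_of ffunE /= /inputs /= tnth_mktuple same_leafE.
have iagr m : multi_pmf p m != 0 -> intg (agr m).
  move=> /supp /(@uniform_ctree R)[t tE].
  have -> : agr m = (fun w => S t i w).
    apply/funext => w; rewrite /agr -tE /S.
    by rewrite /pattern /pattern_of ffunE /= /inputs /= tnth_mktuple same_leafE.
  exact: (intg_pat (fun c => (c (t, i))%:R)).
have iagr2 m : intg (fun w => multi_pmf p m ^+ 2 * agr m w).
  have [->|h] := eqVneq (multi_pmf p m) 0; last by apply: intgZ; exact: iagr.
  by rewrite expr0n /=; under [X in intg X]funext do rewrite mul0r; exact: intg_cst.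
have -> : q * \sum_(m : {ffun 'I_d -> 'I_K.+1}) multi_pmf p m ^+ 2 =
    E (fun w => \sum_m multi_pmf p m ^+ 2 * agr m w).
  rewrite E_sum// mulr_sumr; apply: eq_bigr => m _.
  have [e0|h] := eqVneq (multi_pmf p m) 0.
    rewrite e0 expr0n mulr0; under [X in Rintegral _ _ X]funext do rewrite /= mul0r.
    by rewrite E_cst.
  by rewrite E_Z; [rewrite E_agree 1?mulrC//; exact: supp|exact: iagr].
apply: E_le; [exact: intg_sum|exact: (intg_pat (fun c => conn p c i ^+ 2))|].
move=> w; rewrite connE; apply: le_trans (sum_sqr_le _); last first.
  by move=> m; rewrite mulr_ge0 ?ler0n// multi_pmf_ge0.
(* [box_agree] is a natural number, hence at most its square. *)
apply: ler_sum => m _; rewrite exprMn ler_wpM2l ?sqr_ge0// -natrX ler_nat.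
by case: box_agree => // a; rewrite leq_pmulr.
Qed.

(** With this [b], the bound of [E_conn_count] is [C i / b], so the polynomial bound becomes [3 * b
    ^+ 2 * C i - 2 * b ^+ 2 * C i = b ^+ 2 * C i], the best value over [b]. *)
Lemma sum_wgt_sqr_ge : (0 < n)%N ->
  n%:R * (1 + (n%:R - 1) * q)^-1 ^+ 2 * q *
    \sum_(m : {ffun 'I_d -> 'I_K.+1}) multi_pmf p m ^+ 2 <=
  \sum_(i < n) E (fun w => avg_weight p i (pat w) ^+ 2).
Proof.
move=> n0; set b := (_)^-1; set Q := \sum_m _.
have q0 : 0 < q by rewrite invr_gt0 exprn_gt0.
have n1 : 1 <= n%:R :> R by rewrite -[leLHS]/(1%:R) ler_nat.
have b0 : 0 < b by rewrite invr_gt0; nra.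
have b1 : b * (1 + (n%:R - 1) * q) = 1.
  by rewrite /b mulVf// gt_eqF//; nra.
apply: (@le_trans _ _ (\sum_(i < n) b ^+ 2 * (q * Q))).
  by rewrite sumr_const card_ord -[leRHS]mulr_natl !mulrA.
apply: ler_sum => i _.
apply: (@le_trans _ _ (b ^+ 2 * C i)).
  by rewrite ler_wpM2l ?sqr_ge0// E_conn_sqr.
have i1 : intg (fun w => conn p (pat w) i ^+ 2) by exact: (intg_pat (fun c => conn p c i ^+ 2)).
have i2 : intg (fun w => conn p (pat w) i * conn_count p (pat w) i).
  exact: (intg_pat (fun c => conn p c i * conn_count p c i)).
apply: (@le_trans _ _ (E (fun w => 3 * b ^+ 2 * conn p (pat w) i ^+ 2 +
   - (2 * b ^+ 3) * (conn p (pat w) i * conn_count p (pat w) i)))).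
  rewrite E_D; [|exact: intgZ|exact: intgZ].
  rewrite !E_Z// -/(C i).
  have h := E_conn_count i.
  have : 2 * b ^+ 3 * E (fun w => conn p (pat w) i * conn_count p (pat w) i) <=
     2 * b ^+ 3 * ((1 + (n%:R - 1) * q) * C i).
    by rewrite ler_pM2l// mulr_gt0// exprn_gt0.
  have -> : 2 * b ^+ 3 * ((1 + (n%:R - 1) * q) * C i) =
     2 * b ^+ 2 * C i * (b * (1 + (n%:R - 1) * q)) by ring.
  rewrite b1; lra.
apply: E_le.
- by apply: intgD; exact: intgZ.
- exact: (intg_pat (fun c => avg_weight p i c ^+ 2)).
by move=> w; rewrite mulNr; exact: avg_weight_sqr_ge.
Qed.

End Lower.

(** * Comparison of the number of leaves with [k], and conclusion *)

Lemma depth_bounds {R : realType} (k : R) : 1 <= k ->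
  k <= 2 ^+ depth k /\ 2 ^+ depth k < 2 * k.
Proof.
move=> k1; have k0 : 0 < k by lra.
have ln2 : 0 < ln 2 :> R by rewrite ln_gt0//; lra.
have lk : 0 <= ln k / ln 2 by apply: divr_ge0; [exact: ln_ge0|exact: ltW].
have dE : (depth k)%:R = (Num.ceil (ln k / ln 2))%:~R :> R.
  rewrite /depth -[LHS]mulrz_nat natz gez0_abs// -(ler_int R).
  by apply: le_trans lk _; exact: ceil_ge.
have pow : 2 ^+ depth k = expR ((depth k)%:R * ln 2) :> R.
  by rewrite mulrC expRM_natr lnK// posrE.
have c1 := ceil_ge (ln k / ln 2); have c2 := ceilB1_lt (ln k / ln 2).
rewrite pow dE; split.
  by rewrite -[leLHS](@lnK R)// ler_expR -ler_pdivrMr.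
rewrite -[ltRHS](@lnK R) ?posrE ?mulr_gt0// ltr_expR lnM ?posrE//.
move: c2; rewrite intrB -(ltr_pM2r ln2) mulrBl divfK ?gt_eqF//; lra.
Qed.

(** After clearing denominators it suffices that [k * (N + x) ^+ 2 <= 5 * N * x ^+ 2]. If [N <= x],
    then [k <= N] and [(N + x) ^+ 2 <= 4 * x ^+ 2]. Otherwise [k <= x] is used twice: as a bound on
    the factor [k], and to get [N < 2 * x]. *)
Lemma size_factor_ge {R : realType} (k N : R) (n : nat) : 1 <= k -> k <= n%:R ->
  k <= N -> N < 2 * k ->
  k / (5 * n%:R) <= n%:R * (1 + (n%:R - 1) * N^-1)^-1 ^+ 2 * N^-1.
Proof.
move=> k1 kn kN N2; set x := n%:R in kn *.
have x1 : 1 <= x by lra.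
have N0 : 0 < N by lra.
have -> : x * (1 + (x - 1) * N^-1)^-1 ^+ 2 * N^-1 = x * N / (N + x - 1) ^+ 2.
  by field; rewrite !gt_eqF//; lra.
rewrite ler_pdivlMr; last by rewrite exprn_gt0//; lra.
rewrite mulrAC ler_pdivrMr; last by lra.
apply: (@le_trans _ _ (k * (N + x) ^+ 2)).
  by rewrite ler_pM2l; [nra|lra].
have [Nx|xN] := leP N x.
  have : (N + x) ^+ 2 <= 4 * x ^+ 2 by nra.
  have : k * (N + x) ^+ 2 <= N * (N + x) ^+ 2 by rewrite ler_wpM2r ?sqr_ge0.
  have : N * (N + x) ^+ 2 <= N * (4 * x ^+ 2) by rewrite ler_pM2l//; nra.
  have : 0 < N * x ^+ 2 by rewrite mulr_gt0// exprn_gt0//; lra.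
  lra.
have h : (N + x) ^+ 2 <= 5 * N * x.
  (* Here [x < N < 2 * k <= 2 * x]; expanding the product gives
     [(N + x) ^+ 2 <= 5 * N * x - x ^+ 2], the origin of the 5. *)
  have : (N - x) * (N - 2 * x) <= 0 by rewrite mulr_ge0_le0//; lra.
  have : 0 < x * N by rewrite mulr_gt0//; lra.
  have := sqr_ge0 x.
  lra.
have : k * (N + x) ^+ 2 <= x * (N + x) ^+ 2 by rewrite ler_wpM2r ?sqr_ge0.
have : x * (N + x) ^+ 2 <= x * (5 * N * x) by rewrite ler_pM2l//; lra.
lra.
Qed.

Theorem theorem5 (R : realType) (dO : measure_display)
    (Omega : measurableType dO) (P : probability Omega R) (d n : nat)
    (X : Omega -> d.-tuple R) (Y : Omega -> R)
    (Xs : 'I_n -> Omega -> d.-tuple R) (Ys eps : 'I_n -> Omega -> R)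
    (f : d.-tuple R -> R) (sigma : R)
    (p : 'I_d -> R) (k : R) (Theta : Omega -> ctree d (depth k))
    (EW : 'I_n -> Omega -> R) (Ybar : Omega -> R) :
  regression_model P X Y Xs Ys eps f sigma ->
  centered_forest P X Xs Ys p Theta ->
  forest_weights P X Xs Ys Theta EW ->
  forest_mean P X Xs (forest_predictor Ys EW) Ybar ->
  1 <= k ->
  k <= n%:R ->
  (forall j, j \in active p -> 1 <= (depth k)%:R * p j) ->
  ((sigma ^+ 2 * k / (5 * n%:R) *
     (47 ^- #|active p| /
       (\prod_(j in active p) p j * (depth k)%:R ^+ (#|active p| - 1))))%:E
   <= 'E_P[fun w => ((forest_predictor Ys EW w - Ybar w) ^+ 2)%R])%E.
Proof.
move=> model forest weights mean k1 kn Kp.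
have p0 := forest_p_ge0 forest; have p1 := forest_p_sum forest.
have n0 : (0 < n)%N by rewrite -(ltr_nat R); apply: lt_le_trans kn; lra.
rewrite (mse_eq model forest weights mean) lee_fin -2!mulrA.
rewrite ler_pM2l ?exprn_gt0 ?(model_sigma model)//.
apply: le_trans (sum_wgt_sqr_ge _ model p0 p1 n0).
have [kN N2] := depth_bounds k1.
have hQ := multi_collision p0 p1 Kp; have hN := size_factor_ge k1 kn kN N2.
rewrite mulrA; apply: ler_pM => //.
- by apply: divr_ge0; [exact: le_trans k1|exact: mulr_ge0].
- rewrite divr_ge0 ?invr_ge0 ?exprn_ge0// mulr_ge0 ?exprn_ge0//.
  by apply: prodr_ge0 => j _.
Qed.
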